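(* Let $m\ge 2$ and let $G=CK(2m-1)$. Every blocker for the family of simple Hamiltonian paths of $G$ consists of exactly $m$ edges lying in $m$ pairwise distinct, boundary-consecutive directions (i.e., the directions of the $m$ edges of some boundary path of length $m$), and, up to a cyclic rotation $x\mapsto x+k$ of the vertex labels ($0\le k\le 2m-2$), it is a set of Class A or a set of Class B. Conversely, every set of Class A and every set of Class B is a blocker for the simple Hamiltonian paths of $G$.
   Context: $CK(2m-1)$ is the complete convex geometric graph on $2m-1$ points in convex position in the plane (vertices of a convex polygon $P$), labelled clockwise $0,1,\dots,2m-2$ and regarded as elements of $\mathbb{Z}_{2m-1}$; its edges are all segments $[i,j]$, $i\ne j$. The boundary edges are $[i,i+1]$ (indices mod $2m-1$). The direction of an edge $[i,j]$ is $i+j \pmod{2m-1}$; two edges are parallel if they have the same direction. Two directions are boundary-consecutive if they differ by $2 \pmod{2m-1}$ (they contain consecutive boundary edges). The distance between vertices $i,j$ is $\min(|i-j|,(2m-1)-|i-j|)$. A simple Hamiltonian path (SHP) is a path in $G$ through all vertices whose edges pairwise do not cross. A blocker for SHPs is a set of edges of smallest possible size having an edge in common with every SHP. All vertex indices below are taken mod $2m-1$. Class A: sets consisting of the following edges, for integers $\alpha,\delta\ge 0$ with $\alpha+\delta\le m-2$: (1) all edges of the boundary path $\langle \alpha,\alpha+1,\dots,m-\delta\rangle$; (2) the edges $[i-1-\epsilon_i,\,i+\epsilon_i]$, $1\le i\le\alpha$, where $\epsilon_1>\epsilon_2>\dots>\epsilon_\alpha>0$ and $\alpha-i+1\le\epsilon_i\le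 m-\delta-i-1$; (3) the edges $[m-j-\xi_j,\,m-j+1+\xi_j]$, $1\le j\le\delta$, where $\xi_1>\xi_2>\dots>\xi_\delta>0$ and $\delta+1-j\le\xi_j\le m-j-\alpha-1$; and in addition $\epsilon_1+\xi_1\le m-2$ (when both $\alpha,\delta>0$). Class B: sets consisting of the following edges, for integers $\alpha,\delta\ge0$, $\beta,\gamma\ge 2$ with $\alpha+\delta\le m-5$ and $\beta+\gamma=m-\alpha-\delta-1$: (1)–(2) all edges of the boundary paths $\langle\alpha,\dots,\alpha+\beta\rangle$ and $\langle\alpha+\beta+1,\dots,m-\delta\rangle$; (3) the edge $[\alpha+\beta-\eta,\,\alpha+\beta+1+\eta]$ for some integer $1\le\eta\le\min(\beta-1,\gamma-1)$; (4) the edges $[i-1-\epsilon_i,\,i+\epsilon_i]$, $1\le i\le\alpha$, where $\alpha+\beta-1>\epsilon_1>\epsilon_2>\dots>\epsilon_\alpha>0$; (5) the edges $[m-j-\xi_j,\,m-j+1+\xi_j]$, $1\le j\le\delta$, where $\gamma+\delta-1>\xi_1>\xi_2>\dots>\xi_\delta>0$. *)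

(* Defs.v *)
From mathcomp Require Import all_boot all_order all_algebra.
Set Implicit Arguments. Unset Strict Implicit. Unset Printing Implicit Defensive.
Import GRing.Theory Num.Theory.

(* Number of vertices of CK(2m-1): N m = 2m-1 (for m >= 1). *)
Definition N (m : nat) : nat := (2 * m - 2).+1.

Notation V m := 'I_(2 * m - 2).+1.

Definition vx (m : nat) (z : int) : V m :=
  inord `|(z %% (N m)%:Z)%Z|%N.

Definition edge (m : nat) (a b : V m) : {set V m} := [set a; b].

Definition is_edge (m : nat) (e : {set V m}) : bool := #|e| == 2.

(* Two edges cross: they share no endpoint and their endpoints interleave
   in the cyclic (clockwise) order of the convex polygon. *)
Definition cross (m : nat) (e f : {set V m}) : Prop :=
  exists a b c d : V m,
    [/\ e = edge a b, f = edge c d, (a < b)%N,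
        c \notin e /\ d \notin e &
        ((a < c < b)%N != (a < d < b)%N)].

Definition path_edges (m : nat) (p : seq (V m)) : seq {set V m} :=
  [seq edge xy.1 xy.2 | xy <- zip p (behead p)].

Definition SHP (m : nat) (p : seq (V m)) : Prop :=
  [/\ uniq p, size p = N m &
      forall e f, e \in path_edges p -> f \in path_edges p -> ~ cross e f].

Definition hits_all_SHP (m : nat) (B : {set {set V m}}) : Prop :=
  forall p : seq (V m), SHP p -> exists2 e, e \in B & e \in path_edges p.

Definition blocker (m : nat) (B : {set {set V m}}) : Prop :=
  [/\ {subset B <= is_edge (m:=m)}, hits_all_SHP B &
      forall B' : {set {set V m}}, {subset B' <= is_edge (m:=m)} ->
        hits_all_SHP B' -> #|B| <= #|B'| ].

Definition dir (m : nat) (e : {set V m}) : V m :=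
  vx m (\sum_(x in e) (x : nat))%:Z.

Definition rot_edges (m : nat) (k : V m) (C : {set {set V m}})
  : {set {set V m}} :=
  [set (fun x : V m => vx m (x%:Z + k%:Z)%R) @: e | e : {set V m} in C].

Definition bpath (m s t : nat) : {set {set V m}} :=
  [set edge (vx m u%:Z) (vx m u.+1%:Z) | u : 'I_m.+1 & (s <= u < t)%N].

Definition left_edges (m alpha : nat) (eps : nat -> nat) : {set {set V m}} :=
  [set edge (vx m (i%:Z - 1 - (eps i)%:Z)%R) (vx m (i%:Z + (eps i)%:Z)%R)
     | i : 'I_m.+1 & (1 <= i <= alpha)%N].

Definition right_edges (m delta : nat) (xi : nat -> nat) : {set {set V m}} :=
  [set edge (vx m (m%:Z - j%:Z - (xi j)%:Z)%R)
            (vx m (m%:Z - j%:Z + 1 + (xi j)%:Z)%R)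
     | j : 'I_m.+1 & (1 <= j <= delta)%N].

Definition ClassA (m : nat) (C : {set {set V m}}) : Prop :=
  exists (alpha delta : nat) (eps xi : nat -> nat),
    [/\ (alpha + delta + 2 <= m)%N,
        (forall i, (1 <= i)%N -> (i < alpha)%N -> (eps i.+1 < eps i)%N) /\
        (forall i, (1 <= i <= alpha)%N ->
           [/\ (0 < eps i)%N, (alpha - i + 1 <= eps i)%N &
               (eps i + delta + i + 1 <= m)%N]),
        (forall j, (1 <= j)%N -> (j < delta)%N -> (xi j.+1 < xi j)%N) /\
        (forall j, (1 <= j <= delta)%N ->
           [/\ (0 < xi j)%N, (delta + 1 - j <= xi j)%N &
               (xi j + j + alpha + 1 <= m)%N]),
        ((0 < alpha)%N -> (0 < delta)%N -> (eps 1 + xi 1 + 2 <= m)%N) &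
        C = bpath m alpha (m - delta) :|: left_edges m alpha eps
              :|: right_edges m delta xi].

Definition ClassB (m : nat) (C : {set {set V m}}) : Prop :=
  exists (alpha delta beta gamma eta : nat) (eps xi : nat -> nat),
    [/\ [/\ (2 <= beta)%N, (2 <= gamma)%N, (alpha + delta + 5 <= m)%N &
        (beta + gamma + alpha + delta + 1 = m)%N],
        (1 <= eta)%N /\ (eta <= minn (beta - 1) (gamma - 1))%N,
        [/\ (0 < alpha)%N -> (eps 1 + 1 < alpha + beta)%N,
            (forall i, (1 <= i)%N -> (i < alpha)%N -> (eps i.+1 < eps i)%N) &
            (forall i, (1 <= i <= alpha)%N -> (0 < eps i)%N)],
        [/\ (0 < delta)%N -> (xi 1 + 1 < gamma + delta)%N,
            (forall j, (1 <= j)%N -> (j < delta)%N -> (xi j.+1 < xi j)%N) &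
            (forall j, (1 <= j <= delta)%N -> (0 < xi j)%N)] &
        C = bpath m alpha (alpha + beta) :|: bpath m (alpha + beta).+1 (m - delta)
              :|: [set edge (vx m (alpha%:Z + beta%:Z - eta%:Z)%R)
                            (vx m (alpha%:Z + beta%:Z + 1 + eta%:Z)%R)]
              :|: left_edges m alpha eps :|: right_edges m delta xi].

(* Main.v *)
Require Import Defs.
From mathcomp Require Import all_boot all_order all_algebra.
From mathcomp Require Import zify.
Set Implicit Arguments. Unset Strict Implicit. Unset Printing Implicit Defensive.
Import Order.TTheory GRing.Theory Num.Theory.

(** A simple Hamiltonian path visits, at every time, an arc [l..r] of the polygon
    and stands at one of its two ends; so it is a lattice path in the plane with
    coordinates c = l + r and s = r - l, running from s = 0 to s = 2m - 2.  A
    repeated step uses a boundary edge, and a turn uses the chord [l, r] of the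
    arc just reached.

    The zigzag paths use only two consecutive directions, which forces a blocker
    to have m edges in m boundary-consecutive directions; after a rotation they
    are [i-1-e_i, i+e_i], 1 <= i <= m.  In the (c, s)-plane these chords are the
    points (2i-1, 2e_i+1) and, for the complementary arcs, (2i-2+2m, 2m-2-2e_i),
    which trace a closed curve around the cylinder.  Every lattice path starts below
    the curve and ends above it, and to avoid the chords it must cross between two
    neighbouring points of the curve by straight steps, i.e. along boundary edges.
    One step suffices, except between the adjacent columns i = m and i = 1, where
    two are needed.  So the set is a blocker iff it contains all boundary edges
    usable for crossing elsewhere, and all but at most one of those usable
    between the columns m and 1.  This gives inequalities on e
    ([descent_ok], [ascent_ok], [ends_ok], [middle_ok]) whose solutions are
    exactly the classes A and B. *)

(** * Integer representatives of residues modulo [2m - 1] *)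

Section MulSmall.
Local Open Scope ring_scope.

Lemma mul_small (q b : int) : - b < q * b < b -> q = 0.
Proof. by case: (ltrgtP q 0) => //; nia. Qed.

End MulSmall.

Section Residues.
Local Open Scope ring_scope.
Variables (m : nat) (hm : (2 <= m)%N).
Notation n := (2 * m%:Z - 1).

Lemma N_E : (N m)%:Z = n.
Proof. rewrite /N; lia. Qed.

Lemma vx_val z : (vx m z : nat)%:Z = (z %% n)%Z.
Proof.
rewrite /vx N_E inordK; last first.
  have := @ltz_pmod z n ltac:(lia); have := @modz_ge0 z n ltac:(lia); lia.
have := @modz_ge0 z n ltac:(lia); lia.
Qed.

Lemma vx_eqP x y : (exists q, x = y + q * n) <-> vx m x = vx m y.
Proof.
split=> [[q ->]|/(congr1 (fun i : V m => (i : nat)%:Z))].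
  by apply: val_inj; apply/eqP; rewrite -eqz_nat !vx_val addrC modzMDl.
rewrite !vx_val => E; exists ((x %/ n)%Z - (y %/ n)%Z).
have := divz_eq x n; have := divz_eq y n; rewrite E; lia.
Qed.

Lemma vx_shift q x : vx m (x + q * n) = vx m x.
Proof. by apply/vx_eqP; exists q. Qed.

Lemma vxDn x : vx m (x + n) = vx m x.
Proof. by rewrite -[RHS](vx_shift 1) mul1r. Qed.

Lemma vxBn x : vx m (x - n) = vx m x.
Proof. by rewrite -[RHS](vx_shift (-1)) mulN1r. Qed.

Lemma vx_val_id (v : V m) : vx m (v : nat)%:Z = v.
Proof.
apply: val_inj; apply/eqP; rewrite -eqz_nat vx_val modz_small //.
have := ltn_ord v; lia.
Qed.

Lemma vx_inj_near x y : vx m x = vx m y -> x - n < y < x + n -> x = y.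
Proof.
move=> /vx_eqP[q ->] h; have -> : q = 0 by apply: (@mul_small _ n); lia.
lia.
Qed.

Lemma vx_repr (l : int) (v : V m) : exists2 w, l <= w < l + n & v = vx m w.
Proof.
exists (l + (((v : nat)%:Z - l) %% n)%Z).
  have := @ltz_pmod ((v : nat)%:Z - l) n ltac:(lia).
  have := @modz_ge0 ((v : nat)%:Z - l) n ltac:(lia); lia.
rewrite -[LHS]vx_val_id; apply/vx_eqP; exists (((v : nat)%:Z - l) %/ n)%Z.
have := divz_eq ((v : nat)%:Z - l) n; lia.
Qed.

(** Reading the polygon once around from [x], labels wrap past zero at most once. This turns cyclic
    order into linear arithmetic. *)
Lemma vx_val_near x u : x <= u < x + n ->
  let X := (vx m x : nat)%:Z in let U := (vx m u : nat)%:Z in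
  [/\ 0 <= X < n, 0 <= U < n & U = X + (u - x) \/ U = X + (u - x) - n].
Proof.
move=> hu /=; rewrite !vx_val.
have hX1 := @ltz_pmod x n ltac:(lia); have hX2 := @modz_ge0 x n ltac:(lia).
have hU1 := @ltz_pmod u n ltac:(lia); have hU2 := @modz_ge0 u n ltac:(lia).
split; [lia|lia|].
have E1 := divz_eq x n; have E2 := divz_eq u n.
set X := (x %% n)%Z in hX1 hX2 E1 *; set U := (u %% n)%Z in hU1 hU2 E2 *.
have : (u %/ n)%Z - (x %/ n)%Z = 0 \/ (u %/ n)%Z - (x %/ n)%Z = 1.
  have : -1 < (u %/ n)%Z - (x %/ n)%Z < 2 by nia.
  lia.
by case=> E; [left|right]; rewrite {1}E2 {1}E1 in hu *; nia.
Qed.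

End Residues.

(** * Crossing of chords of the polygon *)

Section Crossing.
Local Open Scope ring_scope.
Variables (m : nat) (hm : (2 <= m)%N).
Notation n := (2 * m%:Z - 1).
Notation ed x y := (edge (vx m x) (vx m y)).

Lemma edgeC (a b : V m) : edge a b = edge b a.
Proof. by rewrite /edge setUC. Qed.

Lemma edge_eqP (a b c d : V m) :
  edge a b = edge c d <-> (a = c /\ b = d) \/ (a = d /\ b = c).
Proof.
split=> [/setP E|[[-> ->]|[-> ->]]] //; last exact: edgeC.
have := E a; have := E b; have := E d; have := E c.
rewrite !inE !eqxx ?orbT /= => /orP hc /orP hd /esym/orP hb /esym/orP ha.
by case: ha => /eqP?; case: hb => /eqP?; case: hc => /eqP?; case: hd => /eqP?;
  subst; auto.
Qed.

Lemma crossC (e f : {set V m}) : cross e f -> cross f e.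
Proof.
have W (a b c d : V m) : (a < b)%N -> (c < d)%N ->
  c \notin edge a b -> d \notin edge a b ->
  ((a < c < b)%N != (a < d < b)%N) -> cross (edge c d) (edge a b).
  rewrite !inE !negb_or -!val_eqE /= => ab cd /andP[? ?] /andP[? ?] h.
  exists c, d, a, b; split; rewrite ?inE ?negb_or -?val_eqE //=; last lia.
  by split; lia.
case=> a [b [c [d [-> -> ab [cn dn] h]]]].
have /orP[cd|dc] : ((c < d) || (d < c))%N.
  rewrite -neq_ltn; apply: contraTneq h => ->; by rewrite eqxx.
- exact: W.
- by rewrite (edgeC c d); apply: W; rewrite // eq_sym.
Qed.

(** Both ends of the second chord lie on the same closed side of the first. *)
Lemma not_cross x y u w : x < y < x + n -> x <= u <= y -> x <= w <= y ->
  ~ cross (ed x y) (ed u w).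
Proof.
move=> hxy hu hw [a [b [c [d [E1 E2 ab [cn dn]]]]]].
have [hX hY cY] := @vx_val_near m hm x y ltac:(lia).
have [_ hU cU] := @vx_val_near m hm x u ltac:(lia).
have [_ hW cW] := @vx_val_near m hm x w ltac:(lia).
move: cn dn; rewrite E1 !inE !negb_or -!val_eqE /=.
move=> /andP[? ?] /andP[? ?].
move/edge_eqP: E1 E2 => [[]|[]] E1 E1' /edge_eqP[[]|[]] E2 E2'; subst;
  lia.
Qed.

Lemma cross_between x y u w : x < u < y -> y < w < x + n ->
  cross (ed x y) (ed u w).
Proof.
move=> hu hw.
have [hX hY cY] := @vx_val_near m hm x y ltac:(lia).
have [_ hU cU] := @vx_val_near m hm x u ltac:(lia).
have [_ hW cW] := @vx_val_near m hm x w ltac:(lia).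
have /orP[cd|dc] : ((vx m x < vx m y) || (vx m y < vx m x))%N by lia.
- exists (vx m x), (vx m y), (vx m u), (vx m w); split=> //; last lia.
  by rewrite !inE !negb_or -!val_eqE /=; lia.
- exists (vx m y), (vx m x), (vx m u), (vx m w); split=> //; last lia.
    exact: edgeC.
  by rewrite !inE !negb_or -!val_eqE /=; lia.
Qed.

End Crossing.

(** * Simple Hamiltonian paths as growing arcs *)

Section Runs.
Local Open Scope ring_scope.

(* [run F l r b]: the arc l..r has been visited along edges allowed by [F], and the
   path stands at its end [r] if [b] holds, and at [l] otherwise. *)
Inductive run (F : int -> int -> Prop) : int -> int -> bool -> Prop :=
| run_start v b : run F v v b
| run_RR l r : run F l r true -> F r (r + 1) -> run F l (r + 1) true
| run_RL l r : run F l r true -> F (l - 1) r -> run F (l - 1) r false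
| run_LL l r : run F l r false -> F (l - 1) l -> run F (l - 1) r false
| run_LR l r : run F l r false -> F l (r + 1) -> run F l (r + 1) true.

Definition complete (m : nat) (F : int -> int -> Prop) : Prop :=
  exists l b, run F l (l + (2 * m%:Z - 2)) b.

Lemma run_le F l r b : run F l r b -> l <= r.
Proof. elim=> *; lia. Qed.

End Runs.

Section RunPath.
Local Open Scope ring_scope.
Variables (m : nat) (hm : (2 <= m)%N).
Notation n := (2 * m%:Z - 1).
Notation ed x y := (edge (vx m x) (vx m y)).

Definition avoids (B : {set {set V m}}) (x y : int) : Prop := ed x y \notin B.

Lemma path_edges_cons2 (x y : V m) p :
  path_edges (x :: y :: p) = edge x y :: path_edges (y :: p).
Proof. by []. Qed.

Lemma path_edgesP (x0 : V m) (p : seq (V m)) e :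
  e \in path_edges p <->
  exists2 t, (t.+1 < size p)%N & e = edge (nth x0 p t) (nth x0 p t.+1).
Proof.
elim: p => [|x [|y p] IH]; first by split=> [|[]].
  by split=> [|[]].
rewrite path_edges_cons2 inE; split=> [/orP[/eqP->|/IH[t ht ->]]|[[|t] ht E]].
- by exists 0%N.
- by exists t.+1.
- by rewrite E eqxx.
- by apply/orP; right; apply/IH; exists t.
Qed.

Lemma not_cross_self (e : {set V m}) : ~ cross e e.
Proof.
case=> a [b [c [d [E1 E2 _ [cn _] _]]]].
by move: cn; rewrite E2 !inE eqxx.
Qed.

(* The path is listed backwards, so that its current end [z] comes first. *)
Definition traced (B : {set {set V m}}) (l r z : int) : Prop :=
  exists p : seq (V m),
  [/\ uniq (vx m z :: p), (size p)%:Z = r - l,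
      (forall v, v \in vx m z :: p -> exists2 y, l <= y <= r & v = vx m y),
      (forall e, e \in path_edges (vx m z :: p) ->
         e \notin B /\ exists u w, [/\ l <= u <= r, l <= w <= r & e = ed u w]) &
      (forall e f, e \in path_edges (vx m z :: p) ->
         f \in path_edges (vx m z :: p) -> ~ cross e f)].

(* The arc [x..y] is the side of the new edge that contains all visited vertices. *)
Lemma traced_step B l r z l' r' z' x y :
  l' <= l -> r <= r' -> r' - l' = r - l + 1 -> r' - l' < n ->
  l <= z <= r -> l' <= z' <= r' -> ~ (l <= z' <= r) ->
  x < y < x + n -> x <= l -> r <= y -> ed x y = ed z' z ->
  avoids B z' z -> traced B l r z -> traced B l' r' z'.
Proof.
move=> hl hr hs hn hz hz' z'lr hxy hx hy E av [p [up sp mp ep xp]].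
exists (vx m z :: p); split.
- rewrite cons_uniq up andbT; apply/negP => /mp[w hw /(vx_inj_near hm) zw].
  apply: z'lr; rewrite zw; lia.
- by rewrite /= -addn1 PoszD sp hs.
- move=> v; rewrite inE => /orP[/eqP->|/mp[w hw ->]]; first by exists z'.
  by exists w => //; lia.
- move=> e; rewrite path_edges_cons2 inE.
  move=> /orP[/eqP->|/ep[eB [u [w [hu hw e_uw]]]]].
    by split=> //; exists z', z; split=> //; lia.
  by split=> //; exists u, w; split=> //; lia.
- have X f : f \in path_edges (vx m z :: p) -> ~ cross (ed x y) f.
    by move=> /ep[_ [u [w [hu hw ->]]]]; apply: not_cross => //; lia.
  move=> e f; rewrite path_edges_cons2 !inE -E.
  move=> /orP[/eqP->|he] /orP[/eqP->|hf].
  + exact: not_cross_self.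
  + exact: X.
  + by move/crossC/(X _ he).
  + exact: xp.
Qed.

Lemma run_traced B l r b : run (avoids B) l r b -> r - l < n ->
  traced B l r (if b then r else l).
Proof.
elim=> {l r b} [v b|l r|l r|l r|l r] => [_|R IH av hn|R IH av hn|R IH av hn|R IH av hn].
- rewrite (_ : (if b then v else v) = v); last by case: b.
  exists [::]; split=> //=; first lia.
  by move=> u; rewrite inE => /eqP ->; exists v => //; lia.
- have lr := run_le R; move: (IH ltac:(lia)).
  (* The boundary edge [[r, r+1]] is read as the chord from [r + 1 - n] to [r], whose arc contains
     all visited vertices. *)
  apply: (@traced_step B l r r l (r + 1) (r + 1) (r + 1 - n) r); try lia.
  + by rewrite vxBn.
  + by rewrite /avoids edgeC.
- have lr := run_le R; move: (IH ltac:(lia)).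
  by apply: (@traced_step B l r r (l - 1) r (l - 1) (l - 1) r); try lia.
- have lr := run_le R; move: (IH ltac:(lia)).
  apply: (@traced_step B l r l (l - 1) r (l - 1) l (l - 1 + n)); try lia.
  + by rewrite vxDn // edgeC.
  + by [].
- have lr := run_le R; move: (IH ltac:(lia)).
  apply: (@traced_step B l r l l (r + 1) (r + 1) l (r + 1)); try lia.
  + by rewrite edgeC.
  + by rewrite /avoids edgeC.
Qed.

Lemma hits_not_complete B : hits_all_SHP B -> ~ complete m (avoids B).
Proof.
move=> H [l [b R]]; have [p [up sp _ ep xp]] := run_traced R ltac:(lia).
have [|e eB] := H (vx m (if b then l + (2 * m%:Z - 2) else l) :: p).
  split=> //; rewrite /= /N; lia.
by move=> /ep[]; rewrite eB.
Qed.

(** A discrete intermediate value argument, used to find the edge by which a path changes sides. *)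
Lemma neighbours_differ (T : Type) (x0 : T) (Q : pred T) (s : seq T) :
  has Q s -> has (predC Q) s ->
  exists2 t, (t.+1 < size s)%N & Q (nth x0 s t) != Q (nth x0 s t.+1).
Proof.
elim: s => [//|x [|y s] IH] /=; first by rewrite !orbF => ->.
have [e|ne _ _] := eqVneq (Q x) (Q y); last by exists 0%N.
rewrite e => h1 h2; have [||t ht hQ] := IH.
- by move: h1 => /=; case: (Q y).
- by move: h2 => /=; case: (Q y).
by exists t.+1.
Qed.

(** An edge to a vertex not next to the visited arc would leave unvisited vertices on both of its
    sides, and the rest of the path would have to cross it. So the visited vertices always form an
    arc that ends at the current vertex. *)
Lemma SHP_run (B : {set {set V m}}) (p : seq (V m)) : SHP p -> (forall e, e \in path_edges p -> e \notin B) ->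
  forall t, (t < N m)%N -> exists l r b,
  [/\ run (avoids B) l r b, r - l = t%:Z,
      nth (vx m 0) p t = vx m (if b then r else l),
      forall z, l <= z <= r -> vx m z \in take t.+1 p &
      forall v, v \in take t.+1 p -> exists2 z, l <= z <= r & v = vx m z].
Proof.
move=> [up sp xp] av; set x0 := vx m 0.
have full v : v \in p.
  have /eqP E : [set x in p] == [set: V m].
    rewrite eqEcard subsetT cardsT card_ord cardsE.
    by rewrite (card_uniqP up) sp /N leqnn.
  by have := in_setT v; rewrite -E inE.
have Nn := N_E hm.
elim=> [|t IH] ht.
  exists (nth x0 p 0 : nat)%:Z, (nth x0 p 0 : nat)%:Z, true.
  have E : take 1 p = [:: nth x0 p 0].
    by rewrite (take_nth x0) ?sp // take0.
  split.
  - exact: run_start.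
  - lia.
  - by rewrite vx_val_id.
  - move=> z hz; have -> : z = (nth x0 p 0 : nat)%:Z by lia.
    by rewrite vx_val_id // E inE.
  - rewrite E => v; rewrite inE => /eqP->; exists (nth x0 p 0 : nat)%:Z; first lia.
    by rewrite vx_val_id.
have [l [r [b [R rl cur tk1 tk2]]]] := IH (ltnW ht).
have tE : take t.+2 p = rcons (take t.+1 p) (nth x0 p t.+1).
  by rewrite (take_nth x0) ?sp.
have ynt : nth x0 p t.+1 \notin take t.+1 p.
  by have := take_uniq t.+2 up; rewrite tE rcons_uniq => /andP[].
have [w hw yw] := vx_repr hm l (nth x0 p t.+1).
have wr : r < w.
  by rewrite ltNge; apply: contra ynt => h; rewrite yw; apply: tk1; lia.
have ye : ed (if b then r else l) w \in path_edges p.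
  by apply/(path_edgesP x0); exists t; rewrite ?sp // -cur -yw.
have yB := av _ ye.
have [wr1|wr1] := eqVneq w (r + 1); last first.
  have [wl1|wl1] := eqVneq w (l - 1 + n); last first.
    exfalso.
    (* [Q] marks the vertices strictly between [r] and [w]. The remaining path meets both sides, so
       some edge of it changes [Q] and crosses the edge to [w]. *)
    pose Q (v : V m) := [exists i : 'I_(N m), (r < l + (i : nat)%:Z < w) && (v == vx m (l + (i : nat)%:Z))].
    have Qn z : l <= z < l + n -> Q (vx m z) = (r < z < w).
      move=> hz; apply/existsP/idP.
        case=> i /andP[hi /eqP /(vx_inj_near hm)]; have := ltn_ord i; lia.
      move=> hz'; have hi : (`|(z - l)| < N m)%N by lia.
      by exists (Ordinal hi) => /=; rewrite (_ : l + _ = z) ?hz' ?eqxx //; lia.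
    have rest z : r < z < l + n -> z != w -> vx m z \in drop t.+2 p.
      move=> hz zw; have := full (vx m z); rewrite -{1}(cat_take_drop t.+2 p).
      rewrite mem_cat tE mem_rcons inE yw => /orP[/orP[|]|] //.
        move=> /eqP /(vx_inj_near hm); lia.
      move=> /tk2[z' hz' /(vx_inj_near hm)]; lia.
    have [||s hs hQ] := @neighbours_differ _ x0 Q (drop t.+2 p).
    - apply/hasP; exists (vx m (r + 1)); first by apply: rest; lia.
      rewrite Qn; lia.
    - apply/hasP; exists (vx m (l - 1 + n)); first by apply: rest; lia.
      rewrite /= Qn; lia.
    move: hs hQ; rewrite size_drop sp !nth_drop => hs hQ.
    have rep i : (t.+2 <= i < N m)%N ->
        exists z, [/\ r < z < l + n, z != w & nth x0 p i = vx m z].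
      move=> hi; have [z hz zE] := vx_repr hm l (nth x0 p i).
      have iT : (nth x0 p i \in take t.+2 p) = false.
        rewrite in_take ?mem_nth ?sp; [|lia..].
        rewrite index_uniq ?sp //; lia.
      exists z; split=> //.
        rewrite ltNge; apply/andP; split; last lia.
        apply/negP => zr; move: iT; rewrite tE mem_rcons inE zE tk1 ?orbT //; lia.
      apply/negP => /eqP zw; move: iT; rewrite tE mem_rcons inE zE yw zw eqxx //.
    have [z1 [hz1 z1w E1]] := rep (t.+2 + s)%N ltac:(lia).
    have [z2 [hz2 z2w E2]] := rep (t.+2 + s.+1)%N ltac:(lia).
    have fe : ed z1 z2 \in path_edges p.
      apply/(path_edgesP x0); exists (t.+2 + s)%N; first by rewrite sp; lia.
      by rewrite -addnS E1 E2.
    apply: (xp _ _ ye fe); move: hQ; rewrite E1 E2 !Qn; [|lia..].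
    have lr := run_le R.
    case: (boolP (r < z1 < w)) => h1; case: (boolP (r < z2 < w)) => // h2 _.
      by apply: cross_between => //; case: (b); lia.
    by rewrite (edgeC (vx m z1)); apply: cross_between => //; case: (b); lia.
  have yl : nth x0 p t.+1 = vx m (l - 1).
    by rewrite yw wl1 vxDn.
  exists (l - 1), r, false; split.
  - move: yB; rewrite wl1 vxDn // => yB.
    case: (b) R yB => R yB.
      by apply: run_RL; rewrite // /avoids edgeC.
    by apply: run_LL; rewrite // /avoids edgeC.
  - lia.
  - exact: yl.
  - move=> z hz; rewrite tE mem_rcons inE yl.
    have [->|zl] := eqVneq z (l - 1); first by rewrite eqxx.
    by rewrite tk1 ?orbT //; lia.
  - move=> v; rewrite tE mem_rcons inE yl => /orP[/eqP->|/tk2[z hz ->]].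
      by exists (l - 1) => //; have := run_le R; lia.
    by exists z => //; lia.
exists l, (r + 1), true; split.
- move: yB; rewrite wr1 => yB.
  by case: (b) R yB => R yB; [apply: run_RR | apply: run_LR].
- lia.
- by rewrite yw wr1.
- move=> z hz; rewrite tE mem_rcons inE yw wr1.
  have [->|zl] := eqVneq z (r + 1); first by rewrite eqxx.
  by rewrite tk1 ?orbT //; lia.
- move=> v; rewrite tE mem_rcons inE yw wr1 => /orP[/eqP->|/tk2[z hz ->]].
    by exists (r + 1) => //; have := run_le R; lia.
  by exists z => //; lia.
Qed.

Lemma not_complete_hits (B : {set {set V m}}) : ~ complete m (avoids B) -> hits_all_SHP B.
Proof.
move=> nc p hp; case: (boolP (has [in B] (path_edges p))) => [/hasP[e ep eB]|nh].
  by exists e.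
case: nc; have av e : e \in path_edges p -> e \notin B.
  by move=> ep; apply: contra nh => eB; apply/hasP; exists e.
(* [leqnn (N m)] is the bound for the last index, [2m - 2]. *)
have [l [r [b [R rl _ _ _]]]] := SHP_run hp av (leqnn (N m)).
exists l, b; move: R; rewrite (_ : r = l + (2 * m%:Z - 2)) //.
by move: rl; rewrite /N; lia.
Qed.

Lemma hits_all_SHP_iff B : hits_all_SHP B <-> ~ complete m (avoids B).
Proof. by split; [apply: hits_not_complete | apply: not_complete_hits]. Qed.

End RunPath.

(** * Curves: one chord in each of [m] boundary-consecutive directions *)

Section Curve.
Local Open Scope ring_scope.
Variables (m : nat) (hm : (2 <= m)%N).
Notation n := (2 * m%:Z - 1).
Notation ed x y := (edge (vx m x) (vx m y)).

(** This chord has direction [2a + 2i - 1] and length [2 e_i + 1]; [e i = 0] gives the boundary edge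
    [[a+i-1, a+i]]. *)
Definition cedge (a : int) (e : nat -> nat) (i : nat) : {set V m} :=
  ed (a + i%:Z - 1 - (e i)%:Z) (a + i%:Z + (e i)%:Z).

Definition curve (a : int) (e : nat -> nat) : {set {set V m}} :=
  [set cedge a e i | i : 'I_m.+1 & (1 <= i <= m)%N].

Lemma curveP a e x :
  reflect (exists2 i : nat, (1 <= i <= m)%N & x = cedge a e i) (x \in curve a e).
Proof.
apply: (iffP imsetP) => [[i]|[i hi ->]].
  by rewrite inE => hi ->; exists i.
have hi' : (i < m.+1)%N by rewrite ltnS; case/andP: hi.
by exists (Ordinal hi'); rewrite ?inE.
Qed.

(* For [x < y < x + n]: the segment [x, y] is not in [curve 0 e].  An edge spans two
   complementary arcs, whence the two clauses. *)
Definition off (e : nat -> nat) (x y : int) : Prop :=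
  forall i q, (1 <= i <= m)%N ->
    ~ (x = i%:Z - 1 - (e i)%:Z + q * n /\ y = i%:Z + (e i)%:Z + q * n) /\
    ~ (x = i%:Z + (e i)%:Z + q * n /\ y = i%:Z - 1 - (e i)%:Z + n + q * n).

(** Keeps [2 e_i + 1] below [2m - 1], so that the two ends are distinct. *)
Definition small (e : nat -> nat) := forall i, (1 <= i <= m)%N -> (e i + 2 <= m)%N.

(** Both lengths lie strictly between [0] and [n]. Hence the ends agree up to the same multiple of
    [n], or, when reversed, up to multiples differing by one: the two clauses of [off]. *)
Lemma off_avoids a e x y : small e -> x < y < x + n ->
  off e x y <-> avoids (curve a e) (x + a) (y + a).
Proof.
move=> se hxy; split=> [o|av i q hi].
  apply/negP => /curveP[i hi]; have := se i hi => ei.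
  move=> /edge_eqP[] [/(vx_eqP hm)[q Eq] /(vx_eqP hm)[q' Eq']].
    have qq : q' - q = 0 by apply: (@mul_small _ n); lia.
    by have [[]] := o i q hi; split; lia.
  have qq : q' - q - 1 = 0 by apply: (@mul_small _ n); lia.
  have [_ []] := o i q hi; split; first lia.
  by rewrite (_ : q = q' - 1) in Eq *; lia.
split=> -[hx hy]; move/negP: av; apply; apply/curveP; exists i => //; apply/edge_eqP.
  by left; split; apply/(vx_eqP hm); exists q; lia.
by right; split; apply/(vx_eqP hm); [exists q|exists (q + 1)]; lia.
Qed.

Lemma run_map (F F' : int -> int -> Prop) a l r b :
  (forall x y, x < y < x + n -> F x y -> F' (x + a) (y + a)) ->
  run F l r b -> r - l < n -> run F' (l + a) (r + a) b.
Proof.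
move=> FF; elim=> {l r b} [v b _|l r|l r|l r|l r]; first exact: run_start.
- move=> R IH h hn; have lr := run_le R.
  have -> : r + 1 + a = r + a + 1 by lia.
  apply: run_RR; first by apply: IH; lia.
  by have := FF r (r + 1) ltac:(lia) h; congr F'; lia.
- move=> R IH h hn; have lr := run_le R.
  have -> : l - 1 + a = l + a - 1 by lia.
  apply: run_RL; first by apply: IH; lia.
  by have := FF (l - 1) r ltac:(lia) h; congr F'; lia.
- move=> R IH h hn; have lr := run_le R.
  have -> : l - 1 + a = l + a - 1 by lia.
  apply: run_LL; first by apply: IH; lia.
  by have := FF (l - 1) l ltac:(lia) h; congr F'; lia.
- move=> R IH h hn; have lr := run_le R.
  have -> : r + 1 + a = r + a + 1 by lia.
  apply: run_LR; first by apply: IH; lia.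
  by have := FF l (r + 1) ltac:(lia) h; congr F'; lia.
Qed.

(** Rotation by [a] translates runs, so only [e] matters from here on. *)
Lemma complete_off a e : small e ->
  complete m (off e) <-> complete m (avoids (curve a e)).
Proof.
move=> se; split=> -[l [b R]].
  exists (l + a), b.
  have -> : l + a + (2 * m%:Z - 2) = l + (2 * m%:Z - 2) + a by lia.
  apply: run_map R _; last lia.
  by move=> x y hxy /(off_avoids a se hxy).
exists (l - a), b.
have -> : l - a + (2 * m%:Z - 2) = l + (2 * m%:Z - 2) - a by lia.
apply: run_map R _; last lia.
move=> x y hxy h; apply/(off_avoids a se); first lia.
by rewrite !subrK.
Qed.

Lemma hits_curve a e : small e ->
  hits_all_SHP (curve a e) <-> ~ complete m (off e).
Proof.
move=> se; rewrite (hits_all_SHP_iff hm).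
by split=> h /(complete_off a se).
Qed.

End Curve.

(** * Zigzag walks *)

Section Zigzag.
Local Open Scope ring_scope.
Variables (m : nat) (F : int -> int -> Prop).

(** Alternate turns use chords with sums [l + r - 1] and [l + r], each one longer than the last. *)
Lemma zigzag_right l r k : run F l r true ->
  (forall x y, r - l < y - x <= r - l + 2 * k%:Z ->
     x + y = l + r - 1 \/ x + y = l + r -> F x y) ->
  run F (l - k%:Z) (r + k%:Z) true.
Proof.
move=> R; elim: k => [|k IH] H; first by rewrite subr0 addr0.
have -> : l - k.+1%:Z = l - k%:Z - 1 by lia.
have -> : r + k.+1%:Z = r + k%:Z + 1 by lia.
apply: run_LR; last by apply: H; lia.
apply: run_RL; last by apply: H; lia.
by apply: IH => x y hs; apply: H; lia.
Qed.

Lemma zigzag_left l r k : run F l r false ->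
  (forall x y, r - l < y - x <= r - l + 2 * k%:Z ->
     x + y = l + r + 1 \/ x + y = l + r -> F x y) ->
  run F (l - k%:Z) (r + k%:Z) false.
Proof.
move=> R; elim: k => [|k IH] H; first by rewrite subr0 addr0.
have -> : l - k.+1%:Z = l - k%:Z - 1 by lia.
have -> : r + k.+1%:Z = r + k%:Z + 1 by lia.
apply: run_RL; last by apply: H; lia.
apply: run_LR; last by apply: H; lia.
by apply: IH => x y hs; apply: H; lia.
Qed.

(** A round of a zigzag lengthens the arc by two; the second case leaves one single step to add. *)
Lemma half_gap (l r : int) : r - l <= 2 * m%:Z - 2 ->
  exists k : nat, r - l + 2 * k%:Z = 2 * m%:Z - 2 \/
                  r - l + 2 * k%:Z = 2 * m%:Z - 3.
Proof.
move=> h; exists (absz (2 * m%:Z - 2 - (r - l))%R)./2; lia.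
Qed.

Lemma zigzag_right_complete l r : run F l r true -> r - l <= 2 * m%:Z - 2 ->
  (forall x y, r - l < y - x <= 2 * m%:Z - 2 ->
     x + y = l + r - 1 \/ x + y = l + r -> F x y) -> complete m F.
Proof.
move=> R h H; have [k hk] := half_gap h.
have Rk : run F (l - k%:Z) (r + k%:Z) true.
  by apply: zigzag_right => // x y hs; apply: H; lia.
case: hk => hk.
  by exists (l - k%:Z), true; rewrite (_ : _ + (_ - _) = r + k%:Z) //; lia.
exists (l - k%:Z - 1), false; rewrite (_ : _ + (_ - _) = r + k%:Z); last lia.
by apply: run_RL => //; apply: H; lia.
Qed.

Lemma zigzag_left_complete l r : run F l r false -> r - l <= 2 * m%:Z - 2 ->
  (forall x y, r - l < y - x <= 2 * m%:Z - 2 ->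
     x + y = l + r + 1 \/ x + y = l + r -> F x y) -> complete m F.
Proof.
move=> R h H; have [k hk] := half_gap h.
have Rk : run F (l - k%:Z) (r + k%:Z) false.
  by apply: zigzag_left => // x y hs; apply: H; lia.
case: hk => hk.
  by exists (l - k%:Z), false; rewrite (_ : _ + (_ - _) = r + k%:Z) //; lia.
exists (l - k%:Z), true; rewrite (_ : _ + (_ - _) = r + k%:Z + 1); last lia.
by apply: run_LR => //; apply: H; lia.
Qed.

End Zigzag.

(** * Necessary conditions on [e] *)

Section Necessity.
Local Open Scope ring_scope.
Variables (m : nat) (hm : (2 <= m)%N) (e : nat -> nat) (se : small m e).
Notation n := (2 * m%:Z - 1).

(** At height [2k] between the columns [i] and [i+1], the crossing step to the right uses
    [[i+k, i+k+1]]. The curve contains it only as its chord of index [i+k+1], with [e = 0]. *)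
Definition descent_ok (m : nat) (e : nat -> nat) := forall i k : nat,
  (1 <= i < m)%N -> (e i.+1 <= k <= e i)%N -> (i + k < m)%N /\ e (i + k).+1 = 0%N.
(** Mirror image: the step to the left uses [[i-k-1, i-k]], of index [i-k]. *)
Definition ascent_ok (m : nat) (e : nat -> nat) := forall i k : nat,
  (1 <= i < m)%N -> (e i <= k <= e i.+1)%N -> (k < i)%N /\ e (i - k)%N = 0%N.
(** The point of height [2 e_1 + 1] in column 1 must lie below the adjacent point of height
    [2m - 2 - 2 e_m] of column [m]. *)
Definition ends_ok (m : nat) (e : nat -> nat) := (e 1 + e m + 2 <= m)%N.
(** Two boundary edges outside the set, with indices in this range, would suffice to pass the gap
    between the columns [m] and [1]. *)
Definition middle_ok (m : nat) (e : nat -> nat) := forall j j' : nat,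
  (e 1 < j)%N -> (j < j')%N -> (j' + e m <= m)%N -> e j = 0%N \/ e j' = 0%N.

(** In this window of sums one meets each lower point once, and only two upper points: that of
    column [m] at sum [0] and that of column [1] at sum [2m]. *)
Lemma off_chord (x y : int) : x < y < x + n -> -1 <= x + y <= 2 * m%:Z ->
  (forall i : nat, (1 <= i <= m)%N -> x + y = 2 * i%:Z - 1 ->
     y - x <> 2 * (e i)%:Z + 1) ->
  (x + y = 0 -> y - x <> 2 * m%:Z - 2 - 2 * (e m)%:Z) ->
  (x + y = 2 * m%:Z -> y - x <> 2 * m%:Z - 2 - 2 * (e 1)%:Z) ->
  off m e x y.
Proof.
move=> hxy hc h1 h2 h3 i q hi; have ei := se hi; split=> -[ex ey].
  have q0 : q = 0.
    by apply: (@mul_small _ (2 * m%:Z - 1)); lia.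
  by apply: (h1 i); lia.
have : q = 0 \/ q = -1.
  have : 0 <= q + 1 <= 1 by nia.
  lia.
case=> q0; rewrite {}q0 in ex ey.
  have i1 : i = 1%N by lia.
  by have ee : e i = e 1%N by [rewrite i1]; apply: h3; lia.
have im : i = m by lia.
by have ee : e i = e m by [rewrite im]; apply: h2; lia.
Qed.

(** Upper points have even length [2m - 2 - 2 e_i], so an edge of length one can only be a lower
    point. *)
Lemma off_boundary (r : int) :
  (forall (j : nat) (q : int), (1 <= j <= m)%N -> r + 1 = j%:Z + q * n -> e j <> 0%N) ->
  off m e r (r + 1).
Proof.
move=> h i q hi; split=> -[ex ey]; last lia.
by apply: (h i q); lia.
Qed.

(* Zigzag in directions 2i-1, 2i, cross by one straight step at height 2k, and end
   with a zigzag in directions 2i, 2i+1; the next lemma does this in reverse order. *)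
Lemma descent_necessary : ~ complete m (off m e) -> descent_ok m e.
Proof.
move=> nc i k hi hk; have ei := @se i ltac:(lia); have ei1 := @se i.+1 ltac:(lia).
case: (boolP ((i + k < m)%N && (e (i + k).+1 == 0%N))) => [/andP[? /eqP ?] //|hn].
case: nc.
have R : run (off m e) (i%:Z - k%:Z) (i%:Z + k%:Z) true.
  apply: zigzag_right; first exact: run_start.
  move=> x y hs hc; apply: off_chord; [lia|lia| |lia|lia].
  move=> i' hi' E; have -> : i' = i by [lia]; lia.
have Rb : run (off m e) (i%:Z - k%:Z) (i%:Z + k%:Z + 1) true.
  apply: run_RR => //; apply: off_boundary => j q hj E.
  have q0 : q = 0 by apply: (@mul_small _ (2 * m%:Z - 1)); lia.
  have ej : j = (i + k).+1 by [lia]; move=> e0; move: hn; rewrite -ej e0; lia.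
apply: zigzag_right_complete Rb _ _; first lia.
move=> x y hs hc; apply: off_chord; [lia|lia| |lia|lia].
move=> i' hi' E; have -> : i' = i.+1 by [lia]; lia.
Qed.

Lemma ascent_necessary : ~ complete m (off m e) -> ascent_ok m e.
Proof.
move=> nc i k hi hk; have ei := @se i ltac:(lia); have ei1 := @se i.+1 ltac:(lia).
case: (boolP ((k < i)%N && (e (i - k)%N == 0%N))) => [/andP[? /eqP ?] //|hn].
case: nc.
have R : run (off m e) (i%:Z - k%:Z) (i%:Z + k%:Z) false.
  apply: zigzag_left; first exact: run_start.
  move=> x y hs hc; apply: off_chord; [lia|lia| |lia|lia].
  move=> i' hi' E; have -> : i' = i.+1 by [lia]; lia.
have Rb : run (off m e) (i%:Z - k%:Z - 1) (i%:Z + k%:Z) false.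
  apply: run_LL => //; rewrite -[X in off m e _ X](subrK 1); apply: off_boundary => j q hj E.
  have q0 : q = 0 by apply: (@mul_small _ (2 * m%:Z - 1)); lia.
  have ej : j = (i - k)%N by [lia]; move=> e0; move: hn; rewrite -ej e0; lia.
apply: zigzag_left_complete Rb _ _; first lia.
move=> x y hs hc; apply: off_chord; [lia|lia| |lia|lia].
move=> i' hi' E; have -> : i' = i by [lia]; lia.
Qed.

(* Zigzag in directions 1, 2, then three consecutive steps to the left, then zigzag
   in directions -1, 0: the two boundary edges used have no direction in the set. *)
Lemma ends_necessary : ~ complete m (off m e) -> ends_ok m e.
Proof.
move=> nc; have e1 := @se 1%N ltac:(lia); have em := @se m ltac:(lia).
case: (boolP (e 1 + e m + 2 <= m)%N) => // hn; case: nc.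
(* With this height the first straight step to the left arrives exactly at the upper point of column
   [m], without using its chord. *)
pose k := (m - 2 - e m)%N.
have R0 : run (off m e) (1 - k%:Z) (1 + k%:Z) true.
  apply: zigzag_right; first exact: run_start.
  move=> x y hs hc; apply: off_chord; [lia|lia| |lia|lia].
  move=> i' hi' E; have -> : i' = 1%N by [lia]; lia.
have R1 : run (off m e) (1 - k%:Z - 1) (1 + k%:Z) false.
  apply: run_RL => //; apply: off_chord; [lia|lia| |lia|lia].
  move=> i' hi' E; have -> : i' = 1%N by [lia]; lia.
(* Modulo [2m - 1] these indices are [m+1, ..., 2m-1], outside the range [1..m]. *)
have far z : 2 - m%:Z <= z <= 0 -> off m e (z - 1) z.
  move=> hz; rewrite -[X in off m e _ X](subrK 1).
  apply: off_boundary => j q hj E.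
  have : q = 0 \/ q + 1 = 0.
    have : -2 < q < 1 by nia.
    lia.
  case=> q0; [|have q1 : q = -1 by lia]; subst; lia.
have R2 : run (off m e) (1 - k%:Z - 1 - 1) (1 + k%:Z) false.
  by apply: run_LL => //; apply: far; lia.
have R3 : run (off m e) (1 - k%:Z - 1 - 1 - 1) (1 + k%:Z) false.
  by apply: run_LL => //; apply: far; lia.
apply: zigzag_left_complete R3 _ _; first lia.
by move=> x y hs hc; apply: off_chord; lia.
Qed.

(* Zigzag in directions -1, 0, then 0, 1, then 1, 2; the two changes use the boundary
   edges [j-1, j] and [j'-1, j'].  The middle part passes between the chords of the
   adjacent directions 0 and 1. *)
Lemma middle_necessary : ~ complete m (off m e) -> middle_ok m e.
Proof.
move=> nc j j' hj hjj hj'; have e1 := @se 1%N ltac:(lia); have em := @se m ltac:(lia).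
case: (boolP ((e j == 0%N) || (e j' == 0%N))) => [/orP[]/eqP|]; try by auto.
rewrite negb_or => /andP[ej ej']; case: nc.
have bd i : (1 <= i <= m)%N -> e i != 0%N -> off m e (i%:Z - 1) (i%:Z - 1 + 1).
  move=> hi ei; apply: off_boundary => i' q hi' E.
  have q0 : q = 0 by apply: (@mul_small _ (2 * m%:Z - 1)); lia.
  have -> : i' = i by lia.
  exact/eqP.
have R0 : run (off m e) (1 - j%:Z) (j%:Z - 1) true.
  have -> : 1 - j%:Z = 0 - (j.-1)%:Z by lia.
  have -> : j%:Z - 1 = 0 + (j.-1)%:Z by lia.
  apply: zigzag_right; first exact: run_start.
  by move=> x y hs hc; apply: off_chord; lia.
have R1 : run (off m e) (1 - j%:Z) (j%:Z - 1 + 1) true.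
  by apply: run_RR => //; apply: bd; lia.
(* Here all lengths exceed [2j - 1], hence [2 e_1 + 1], and stay below [2m - 2 - 2 e_m] because
   [j' + e m <= m]. *)
have R2 : run (off m e) (2 - j'%:Z) (j'%:Z - 1) true.
  have -> : 2 - j'%:Z = 1 - j%:Z - (j' - j.+1)%N%:Z by lia.
  have -> : j'%:Z - 1 = j%:Z - 1 + 1 + (j' - j.+1)%N%:Z by lia.
  apply: zigzag_right => //.
  move=> x y hs hc; apply: off_chord; [lia|lia| |lia|lia].
  move=> i' hi' E; have -> : i' = 1%N by [lia]; lia.
have R3 : run (off m e) (2 - j'%:Z) (j'%:Z - 1 + 1) true.
  by apply: run_RR => //; apply: bd; lia.
apply: zigzag_right_complete R3 _ _; first lia.
move=> x y hs hc; apply: off_chord; [lia|lia| |lia|lia].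
move=> i' hi' E; have -> : i' = 1%N by [lia]; lia.
Qed.

End Necessity.

(** * Sufficiency: an invariant for walks below the curve *)

Section Sufficiency.
Local Open Scope ring_scope.
Variables (m : nat) (hm : (2 <= m)%N) (e : nat -> nat) (se : small m e).
Notation n := (2 * m%:Z - 1).

(* A path can go halfway through the gap between the adjacent columns m and 1 (entering
   from column 1 for [gapL], from column m for [gapR]); it has then used a boundary edge
   [j-1, j] with [e j <> 0], and leaving the gap above the curve needs a second one. *)
Definition gapL (k : nat) :=
  exists j, [/\ e j <> 0%N, (m <= j + k)%N & (j + e m <= m)%N].
Definition gapR (k : nat) :=
  exists j, [/\ e j <> 0%N, (e 1 < j)%N & (j <= k.+1)%N].

(* States below the curve, with [l + r] normalised to one period: [low] and [up] are the
   columns near the points (2i-1, 2e_i+1) and (2i-2+2m, 2m-2-2e_i). *)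
Inductive below : int -> int -> bool -> Prop :=
| below_low_even (i k : nat) (b : bool) of (1 <= i < m)%N
    & (k <= (if b then e i else e i.+1))%N :
    below (i%:Z - k%:Z) (i%:Z + k%:Z) b
| below_low_odd (i k : nat) b of (1 <= i <= m)%N & (k < e i)%N :
    below (i%:Z - 1 - k%:Z) (i%:Z + k%:Z) b
| below_up_even (i k : nat) (b : bool) of (1 <= i <= m)%N & (k + e i + 1 < m)%N
    & (i = 1%N -> b -> (k <= e m)%N \/ gapL k)
    & (i = m -> ~~ b -> (k <= e 1%N)%N \/ gapR k) :
    below (i%:Z + m%:Z - 1 - k%:Z) (i%:Z + m%:Z - 1 + k%:Z) b
| below_up_odd (i k : nat) (b : bool) of (1 <= i < m)%N
    & (k + (if b then e i else e i.+1) + 1 < m)%N :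
    below (i%:Z + m%:Z - 1 - k%:Z) (i%:Z + m%:Z + k%:Z) b
| below_gapL (k : nat) of (e m <= k)%N & (k + e 1%N + 1 < m)%N & gapL k :
    below (m%:Z - 1 - k%:Z) (m%:Z + k%:Z) false
| below_gapR (k : nat) of (e 1%N <= k)%N & (k + e m + 1 < m)%N & gapR k :
    below (2 * m%:Z - 1 - k%:Z) (2 * m%:Z + k%:Z) true.

Definition below_mod l r b := exists q : int, below (l + q * n) (r + q * n) b.

Lemma below_modI q l r b l' r' : below l' r' b ->
  l + q * n = l' -> r + q * n = r' -> below_mod l r b.
Proof. by move=> h el er; exists q; rewrite el er. Qed.

Lemma below_mod0 l r b l' r' : below l' r' b -> l = l' -> r = r' -> below_mod l r b.
Proof. by move=> h -> ->; apply: (below_modI (q := 0) h); rewrite mul0r addr0. Qed.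

Lemma off_low i q x y : off m e x y -> (1 <= i <= m)%N ->
  x = i%:Z - 1 - (e i)%:Z + q * n -> y = i%:Z + (e i)%:Z + q * n -> False.
Proof. by move=> o hi ex ey; have [[]] := o i q hi. Qed.

Lemma off_up i q x y : off m e x y -> (1 <= i <= m)%N ->
  x = i%:Z + (e i)%:Z + q * n -> y = i%:Z - 1 - (e i)%:Z + n + q * n -> False.
Proof. by move=> o hi ex ey; have [_ []] := o i q hi. Qed.

Lemma off_shift q x y : off m e x y -> off m e (x + q * n) (y + q * n).
Proof.
move=> o i q' hi; have [h1 h2] := o i (q' - q) hi.
by split=> -[ex ey]; [apply: h1|apply: h2]; split; lia.
Qed.

Lemma below_short l r b : below l r b -> r - l < 2 * m%:Z - 2.
Proof.
case=> {l r b} [i k b hi hk|i k b hi hk|i k b hi hk _ _|i k b hi hk|k h1 h2 _|k h1 h2 _];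
  try lia.
- have := @se i ltac:(lia); have := @se i.+1 ltac:(lia); case: b hk; lia.
- have := @se i ltac:(lia); lia.
Qed.

Hypotheses (de : descent_ok m e) (ae : ascent_ok m e).
Hypotheses (ee : ends_ok m e) (me : middle_ok m e).

(** Where a step would lead above the curve, a turn would use a chord of the curve itself, and a
    straight step a boundary edge which [de], [ae] or, in the gap, [me] places in the set. [ee]
    handles the passage from lower column [m] to upper column [1]. *)
Lemma below_R l r b : below l r b -> off m e (if b then r else l) (r + 1) ->
  below_mod l (r + 1) true.
Proof.
case=> {l r b} [i k b hi hk|i k b hi hk|i k b hi hk g1 g2|i k b hi hk|k h1 h2 g|k h1 h2 g] o.
- have [ki|ki] := ltnP k (e i.+1).
    by apply: (below_mod0 (@below_low_odd i.+1 k true _ ki)); lia.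
  exfalso; case: b hk o => hk o.
    have [ikm e0] := de (i := i) (k := k) hi ltac:(lia).
    by apply: (@off_low (i + k).+1 0 _ _ o); lia.
  by apply: (@off_low i.+1 0 _ _ o); lia.
- have [im|im] := ltnP i m.
    by apply: (below_mod0 (@below_low_even i k.+1 true _ _)) => /=; lia.
  have {}im : i = m by lia.
  rewrite im in hk *; move: ee; rewrite /ends_ok => ee'.
  by apply: (below_mod0 (@below_up_even 1 k.+1 true _ _ _ _)) => /=; try lia; left.
- have [im|im] := ltnP i m.
    by apply: (below_mod0 (@below_up_odd i k true _ _)) => /=; lia.
  have {}im : i = m by lia.
  rewrite im in hk g1 g2 o *.
  have [k1|k1] := ltnP k (e 1%N).
    by apply: (below_modI (q := -1) (@below_low_odd 1 k true _ k1)); lia.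
  apply: (below_mod0 (@below_gapR k k1 _ _)); try lia.
  case: b o g1 g2 => o _ g2.
    (* The straight step uses [[k, k+1]] modulo [n]; being allowed, it is the boundary edge that
       [gapR] records. *)
    case: (eqVneq (e k.+1) 0%N) => [e0|/eqP e0]; last by exists k.+1; split=> //; lia.
    by case: (@off_low k.+1 1 _ _ o); lia.
  have [//|km|//] := g2 erefl.
  by case: (@off_low 1%N 1 _ _ o); lia.
- have [ki|ki] := ltnP (k + e i.+1 + 2) m.
    by apply: (below_mod0 (@below_up_even i.+1 k.+1 true _ _ _ _)) => /=; lia.
  exfalso; case: b hk o => hk o.
    (* Seen from the complementary arc, [k] becomes [m - 2 - k], so a step to the right at the upper
       columns falls under the ascent condition. *)
    have [ikm e0] := ae (i := i) (k := (m - 2 - k)%N) hi ltac:(lia).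
    by apply: (@off_low (i - (m - 2 - k))%N 1 _ _ o); lia.
  by apply: (@off_up i.+1 0 _ _ o); lia.
- have [km|km] := ltnP (k + e 1%N + 2) m; last first.
    by case: (@off_up 1%N 0 _ _ o); lia.
  apply: (below_mod0 (@below_up_even 1 k.+1 true _ _ _ _)) => /=; try lia.
  by move=> _ _; right; case: g => j [? ? ?]; exists j; split=> //; lia.
(* Leaving the gap upwards needs a second boundary edge, of index [k+2]. *)
- exfalso; case: g => j [ej hj jk].
  have [//|ek] := @me j k.+2 hj ltac:(lia) ltac:(lia).
  by apply: (@off_low k.+2 1 _ _ o); lia.
Qed.

(** Mirror image of [below_R], with the roles of [de] and [ae], and of the two gaps, exchanged. *)
Lemma below_L l r b : below l r b -> off m e (l - 1) (if b then r else l) ->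
  below_mod (l - 1) r false.
Proof.
case=> {l r b} [i k b hi hk|i k b hi hk|i k b hi hk g1 g2|i k b hi hk|k h1 h2 g|k h1 h2 g] o.
- have [ki|ki] := ltnP k (e i).
    by apply: (below_mod0 (@below_low_odd i k false _ ki)); lia.
  exfalso; case: b hk o => hk o.
    by apply: (@off_low i 0 _ _ o); lia.
  have [ikm e0] := ae (i := i) (k := k) hi ltac:(lia).
  by apply: (@off_low (i - k)%N 0 _ _ o); lia.
- have [im|im] := ltnP 1 i.
    apply: (below_mod0 (@below_low_even i.-1 k.+1 false _ _)) => /=; try lia.
    by rewrite prednK //; lia.
  have {}im : i = 1%N by lia.
  rewrite im in hk *; move: ee; rewrite /ends_ok => ee'.
  by apply: (below_modI (q := 1) (@below_up_even m k.+1 false _ _ _ _)) => /=; try lia; left.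
- have [im|im] := ltnP 1 i.
    apply: (below_mod0 (@below_up_odd i.-1 k false _ _)) => /=; try lia.
    by rewrite prednK //; lia.
  have {}im : i = 1%N by lia.
  rewrite im in hk g1 g2 o *.
  have [k1|k1] := ltnP k (e m).
    by apply: (below_mod0 (@below_low_odd m k false _ k1)); lia.
  apply: (below_mod0 (@below_gapL k k1 _ _)); try lia.
  case: b o g1 g2 => o g1 _.
    have [//|km|//] := g1 erefl.
    by case: (@off_low m 0 _ _ o); lia.
  case: (eqVneq (e (m - k)%N) 0%N) => [e0|/eqP e0].
    by case: (@off_low (m - k)%N 0 _ _ o); lia.
  by exists (m - k)%N; split=> //; lia.
- have [ki|ki] := ltnP (k + e i + 2) m.
    by apply: (below_mod0 (@below_up_even i k.+1 false _ _ _ _)) => /=; lia.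
  exfalso; case: b hk o => hk o.
    by apply: (@off_up i 0 _ _ o); lia.
  have [ikm e0] := de (i := i) (k := (m - 2 - k)%N) hi ltac:(lia).
  by apply: (@off_low (i + (m - 2 - k)).+1 0 _ _ o); lia.
- exfalso; case: g => j [ej jk hj].
  have [ek|//] := @me (m - 1 - k)%N j ltac:(lia) ltac:(lia) hj.
  by apply: (@off_low (m - 1 - k)%N 0 _ _ o); lia.
- have [km|km] := ltnP (k + e m + 2) m; last first.
    by case: (@off_up m 0 _ _ o); lia.
  apply: (below_mod0 (@below_up_even m k.+1 false _ _ _ _)) => /=; try lia.
  by move=> _ _; right; case: g => j [? ? ?]; exists j; split=> //; lia.
Qed.

Lemma below_start v b : below_mod v v b.
Proof.
have h1 := @ltz_pmod (v - 1) n ltac:(lia); have h2 := @modz_ge0 (v - 1) n ltac:(lia).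
have E := divz_eq (v - 1) n; set q := ((v - 1) %/ n)%Z in E.
set w := ((v - 1) %% n)%Z in h1 h2 E.
have hv : v + - q * n = w + 1 by lia.
(* Of the representatives [1..2m-1], those below [m] start between lower columns, the others at
   upper columns, all with [k = 0]. *)
case: (ltrP (w + 1) m%:Z) => hw; exists (- q); rewrite hv.
  pose i := absz (w + 1)%R.
  have -> : w + 1 = i%:Z by lia.
  rewrite -{1}[i%:Z]subr0 -[X in below _ X _]addr0.
  by apply: (@below_low_even i 0 b); lia.
pose i := absz (w + 2 - m%:Z)%R.
have E1 : w + 1 = i%:Z + m%:Z - 1 - 0%N%:Z by lia.
have E2 : w + 1 = i%:Z + m%:Z - 1 + 0%N%:Z by lia.
rewrite {1}E1 E2; have ei := @se i ltac:(lia).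
by apply: (@below_up_even i 0 b); try lia; move=> *; left.
Qed.

(** [below] holds at every start and survives both kinds of step, while a complete arc is too long
    for it. *)
Lemma not_complete_off : ~ complete m (off m e).
Proof.
move=> [l [b R]].
suff [q /below_short] : below_mod l (l + (2 * m%:Z - 2)) b by lia.
elim: R => {l b} [v b|l r _ [q h] o|l r _ [q h] o|l r _ [q h] o|l r _ [q h] o].
- exact: below_start.
- have := off_shift q o; rewrite (_ : r + 1 + q * n = r + q * n + 1); last lia.
  move=> /(below_R h)[q' h']; exists (q + q').
  by move: h'; congr below; lia.
- have := off_shift q o; rewrite (_ : l - 1 + q * n = l + q * n - 1); last lia.
  move=> /(below_L h)[q' h']; exists (q + q').
  by move: h'; congr below; lia.
- have := off_shift q o; rewrite (_ : l - 1 + q * n = l + q * n - 1); last lia.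
  move=> /(below_L h)[q' h']; exists (q + q').
  by move: h'; congr below; lia.
- have := off_shift q o; rewrite (_ : r + 1 + q * n = r + q * n + 1); last lia.
  move=> /(below_R h)[q' h']; exists (q + q').
  by move: h'; congr below; lia.
Qed.

End Sufficiency.

(** * Solving the inequalities on [e] *)

Section Profile.
Variables (m : nat) (hm : 2 <= m).

(* The possible bump of class B sits at [p]; in class A, [e p = 0] or [p] is outside
   the middle range. *)
Definition profile (e : nat -> nat) (al de p : nat) :=
  [/\ al + de + 2 <= m,
      forall i, 1 <= i <= al ->
        [/\ 0 < e i, al < e i + i, e i + de + i < m & i < al -> e i.+1 < e i],
      forall i, m - de < i <= m ->
        [/\ 0 < e i, i <= m - de + e i, al + e i + 1 < i & m - de + 1 < i -> e i.-1 < e i],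
      (0 < al -> 0 < de -> e 1 + e m + 2 <= m) /\
      (forall i, al < i <= m - de -> i <> p -> e i = 0) &
      al < p <= m - de -> 0 < e p ->
        [/\ al + e p + 1 < p, p + e p + 1 <= m - de,
            forall i, 1 <= i <= al -> e i + i + 1 < p &
            forall i, m - de < i <= m -> p + e i + 1 < i]].

Lemma profile_small e al de p : profile e al de p -> small m e.
Proof.
case=> h1 hL hR [_ h0] hp i hi.
have [ia|ia] := leqP i al; first by have [_ _ ? _] := hL i ltac:(lia); lia.
have [id|id] := ltnP (m - de) i; first by have [_ _ ? _] := hR i ltac:(lia); lia.
have [ip|/eqP ip] := eqVneq i p; last by rewrite h0 //; lia.
subst i; have [->|e0] := posnP (e p); first lia.
by have [? ? _ _] := hp ltac:(lia) e0; lia.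
Qed.

Lemma profile_ends e al de p : profile e al de p -> ends_ok m e.
Proof.
case=> h1 hL hR [he h0] hp; rewrite /ends_ok.
have [a0|a0] := posnP al; have [d0|d0] := posnP de.
- have -> : e 1 = 0.
    have [p1|/eqP p1] := eqVneq 1 p; last by apply: h0; lia.
    rewrite p1; have [//|e0] := posnP (e p); have [? ? _ _] := hp ltac:(lia) e0; lia.
  have -> // : e m = 0.
  have [p1|/eqP p1] := eqVneq m p; last by apply: h0; lia.
  rewrite p1; have [//|e0] := posnP (e p); have [? ? _ _] := hp ltac:(lia) e0; lia.
- have -> : e 1 = 0.
    have [p1|/eqP p1] := eqVneq 1 p; last by apply: h0; lia.
    rewrite p1; have [//|e0] := posnP (e p); have [? ? _ _] := hp ltac:(lia) e0; lia.
  have [? ? ? _] := hR m ltac:(lia); lia.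
- have -> : e m = 0.
    have [p1|/eqP p1] := eqVneq m p; last by apply: h0; lia.
    rewrite p1; have [//|e0] := posnP (e p); have [? ? _ _] := hp ltac:(lia) e0; lia.
  have [? ? ? _] := hL 1 ltac:(lia); lia.
- exact: he.
Qed.

Lemma profile_middle e al de p : profile e al de p -> middle_ok m e.
Proof.
case=> h1 hL hR [he h0] hp j j' hj jj hj'.
have ja : al < j.
  have [->|a0] := posnP al; first lia.
  have [? ? ? _] := hL 1 ltac:(lia); lia.
have jd : j' <= m - de.
  have [->|a0] := posnP de; first lia.
  have [? ? ? _] := hR m ltac:(lia); lia.
have [jp|/eqP jp] := eqVneq j p; last by left; apply: h0; lia.
by right; apply: h0; lia.
Qed.

(** A descent starts on the left slope or at the bump, apart from equal zeros; the index [i+k+1]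
    then falls in the middle range away from a bump, where [e] vanishes. *)
Lemma profile_descent e al de p : profile e al de p -> descent_ok m e.
Proof.
case=> h1 hL hR [he h0] hp i k hi hk.
have [ia|ia] := leqP i al.
  have [pi ai im di] := hL i ltac:(lia).
  have z : al < (i + k).+1 <= m - de.
    have [i1|i1] := ltnP i al; last lia.
    by have [] := hL i.+1; lia.
  split; first lia.
  have [E|/eqP ip] := eqVneq (i + k).+1 p; last by apply: h0; lia.
  case: (posnP (e p)) => [|e0]; first by rewrite -E.
  by have [_ _ /(_ i) h _] := hp ltac:(lia) e0; lia.
have [id|id] := ltnP (m - de) i.
  by have [] := hR i.+1; rewrite /=; lia.
have [ip|/eqP ip] := eqVneq i p; last first.
  have ei : e i = 0 by apply: h0; lia.
  have k0 : k = 0 by lia.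
  by rewrite k0 addn0; split; lia.
have [e0|e0] := posnP (e i).
  by have k0 : k = 0 by [lia]; rewrite k0 addn0; split; lia.
have [ap pd _ _] := hp ltac:(lia) ltac:(by rewrite -ip).
rewrite -ip in ap pd.
by split; [lia|apply: h0; lia].
Qed.

Lemma profile_ascent e al de p : profile e al de p -> ascent_ok m e.
Proof.
case=> h1 hL hR [he h0] hp i k hi hk.
have [id|id] := leqP (m - de) i.
  have [pi ai im di] := hR i.+1 ltac:(lia).
  have z : al < i - k <= m - de.
    have [i1|i1] := ltnP (m - de) i; last lia.
    by have [] := hR i; lia.
  split; first lia.
  have [E|/eqP ip] := eqVneq (i - k) p; last by apply: h0; lia.
  case: (posnP (e p)) => [|e0]; first by rewrite -E.
  by have [_ _ _ /(_ i.+1) h] := hp ltac:(lia) e0; lia.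
have [ia|ia] := ltnP i al.
  by have [] := hL i; lia.
have [ip|/eqP ip] := eqVneq i.+1 p; last first.
  have ei : e i.+1 = 0 by apply: h0; lia.
  have k0 : k = 0 by lia.
  by rewrite k0 subn0; split; lia.
have [e0|e0] := posnP (e i.+1).
  by have k0 : k = 0 by [lia]; rewrite k0 subn0; split; lia.
have [ap pd _ _] := hp ltac:(lia) ltac:(by rewrite -ip).
rewrite -ip in ap pd.
by split; [lia|apply: h0; lia].
Qed.

(** [al + 1] is the first zero of [e]. Before it [e] must fall, since an ascent at [i] would force
    an earlier zero at [i - e i]. *)
Lemma left_slope e : small m e -> descent_ok m e -> ascent_ok m e ->
  exists al, [/\ al < m, e al.+1 = 0 &
    forall i, 1 <= i <= al -> [/\ 0 < e i, e i.+1 < e i, al < e i + i,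
      e i + i < m & forall z, al < z <= (i + e i).+1 -> e z = 0]].
Proof.
move=> se de ae.
have down i : 1 <= i < m -> (forall j, 1 <= j <= i -> 0 < e j) -> e i.+1 < e i.
  move=> hi pos; rewrite ltnNge; apply/negP => h.
  have [ki z] := @ae i (e i) hi ltac:(lia).
  by have := pos (i - e i); rewrite z; have := pos i; lia.
(* If [e 1 > 0], the descent from [1] to [2] at height [e 1] yields a zero. *)
have ex0 : exists al, (al < m) && (e al.+1 == 0).
  have [e1|e1] := posnP (e 1); first by exists 0; rewrite e1 /=; lia.
  have e2 : e 2 < e 1.
    by apply: down; [lia|move=> j hj; have -> : j = 1 by lia].
  have [h z] := @de 1 (e 1) ltac:(lia) ltac:(lia).
  by exists (1 + e 1); rewrite z h.
case: (ex_minnP ex0) => al /andP[am /eqP a0] amin.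
exists al; split=> //.
have pos i : 1 <= i <= al -> 0 < e i.
  move=> hi; rewrite lt0n; apply/negP => ei.
  by have := amin i.-1; rewrite prednK; lia.
(* Induction from [al] down to [1]: each descent extends the interval of zeros produced by the
   previous one. *)
have P t : t < al -> let i := al - t in [/\ 0 < e i, e i.+1 < e i, al < e i + i,
      e i + i < m & forall z, al < z <= (i + e i).+1 -> e z = 0].
  elim: t => [|t IH] ht /=.
    rewrite subn0; have pa := pos al ltac:(lia).
    have D k : k <= e al -> al + k < m /\ e (al + k).+1 = 0.
      by move=> hk; apply: de; lia.
    split; [lia|lia|lia| |]; first by have [] := D _ (leqnn _); lia.
    move=> z hz; have [_] := D (z - al.+1) ltac:(lia).
    by rewrite (_ : (_ + _).+1 = z) //; lia.
  have [p1 d1 a1 m1 z1] := IH ltac:(lia).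
  have E : al - t = (al - t.+1).+1 by lia.
  rewrite {}E in p1 d1 a1 m1 z1; set i := al - t.+1 in p1 d1 a1 m1 z1 *.
  have di : e i.+1 < e i by apply: down => [|j hj]; [lia|apply: pos; lia].
  have D k : e i.+1 <= k <= e i -> i + k < m /\ e (i + k).+1 = 0.
    by move=> hk; apply: de; lia.
  split; [lia|lia|lia| |]; first by have [] := D (e i); lia.
  move=> z hz; have [zi|zi] := leqP z (i.+1 + e i.+1).+1; first by apply: z1; lia.
  have [_] := D (z - i.+1) ltac:(lia).
  by rewrite (_ : (_ + _).+1 = z) //; lia.
move=> i hi; have := P (al - i) ltac:(lia).
by rewrite /= (_ : al - (al - i) = i) //; lia.
Qed.

(** The reflection of indices [i -> m + 1 - i] exchanges descents and ascents. *)
Lemma right_slope e : small m e -> descent_ok m e -> ascent_ok m e ->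
  exists de, [/\ de < m, e (m - de) = 0 &
    forall i, m - de < i <= m -> [/\ 0 < e i, e i.-1 < e i, i <= m - de + e i,
      e i + 1 < i & forall z, i <= z + e i + 1 -> z <= m - de -> e z = 0]].
Proof.
move=> se de ae; pose e' i := e (m.+1 - i).
have [|||d [dm d0 H]] := @left_slope e'.
- by move=> i hi; apply: se; lia.
- move=> i k hi hk; have [||kx ex] := @ae (m - i) k; first lia.
    move: hk; rewrite /e'; rewrite (_ : m.+1 - i.+1 = m - i); last lia.
    by rewrite (_ : m.+1 - i = (m - i).+1); lia.
  split; first lia.
  by rewrite /e' (_ : m.+1 - _ = m - i - k); lia.
- move=> i k hi hk; have [||kx ex] := @de (m - i) k; first lia.
    move: hk; rewrite /e'; rewrite (_ : m.+1 - i.+1 = m - i); last lia.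
    by rewrite (_ : m.+1 - i = (m - i).+1); lia.
  split; first lia.
  by rewrite /e' (_ : m.+1 - _ = (m - i + k).+1); lia.
exists d; split=> //.
move=> i hi; have := H (m.+1 - i) ltac:(lia); rewrite /e'.
rewrite (_ : m.+1 - (m.+1 - i) = i); last lia.
rewrite (_ : m.+1 - (m.+1 - i).+1 = i.-1); last lia.
case=> h1 h2 h3 h4 h5; split; [lia|lia|lia|lia|].
move=> z hz1 hz2; have := h5 (m.+1 - z) ltac:(lia).
by rewrite (_ : m.+1 - (m.+1 - z) = z) //; lia.
Qed.

Lemma profile_exists e : small m e -> descent_ok m e -> ascent_ok m e ->
  ends_ok m e -> middle_ok m e -> exists al de p, profile e al de p.
Proof.
move=> se ds us ends mid.
have [al [am a0 hL]] := left_slope se ds us.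
have [de [dm d0 hR]] := right_slope se ds us.
have ad : al < m - de.
  by rewrite ltnNge; apply/negP => h; have [] := hL (m - de); lia.
(* For [al > 0] the index [al + 2] is still a zero, so it is not on the right slope, where [e] is
   positive. *)
have ad2 : al + de + 2 <= m.
  have [aa|aa] := posnP al; last first.
    have [_ _ _ _ hz] := hL al ltac:(lia).
    have [pa _ _ _ _] := hL al ltac:(lia).
    have z2 := hz al.+2 ltac:(lia).
    have [_ _ _ a2 _] := hL al ltac:(lia).
    by rewrite leqNgt; apply/negP => h; have [] := hR al.+2; lia.
  have [dd|dd] := posnP de; first lia.
  have [_ _ _ _ hz] := hR (m - de).+1 ltac:(lia).
  have [pa _ _ a2 _] := hR (m - de).+1 ltac:(lia).
  lia.
have e1 p : al < p -> e p != 0 -> (forall i, 1 <= i <= al -> e i + i + 1 < p).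
  move=> ap ep i hi; have [_ _ _ _ hz] := hL i hi.
  by rewrite ltnNge; apply: contraNN ep => h; apply/eqP/hz; lia.
have em p : p <= m - de -> e p != 0 -> (forall i, m - de < i <= m -> p + e i + 1 < i).
  move=> ap ep i hi; have [_ _ _ _ hz] := hR i hi.
  by rewrite ltnNge; apply: contraNN ep => h; apply/eqP/hz; lia.
have e1p p : al < p -> e p != 0 -> e 1 < p.
  move=> ap ep; have [aa|aa] := posnP al; last by have := e1 p ap ep 1; lia.
  by rewrite aa in a0; rewrite a0; lia.
have emp p : p <= m - de -> e p != 0 -> p + e m <= m.
  move=> ap ep; have [aa|aa] := posnP de; last by have := em p ap ep m; lia.
  by rewrite aa subn0 in d0 ap; rewrite d0; lia.
(* The slopes settle every clause except these two on the middle range. *)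
have com : forall p, profile e al de p <->
   (forall i, al < i <= m - de -> i <> p -> e i = 0) /\
   (al < p <= m - de -> 0 < e p -> al + e p + 1 < p /\ p + e p + 1 <= m - de).
  move=> p; split=> [[_ _ _ [_ h0] hp]|[h0 hp]].
    by split=> // h1 h2; have [] := hp h1 h2.
  split=> //.
  - move=> i hi; have [p1 d1 a1 m1 z1] := hL i hi; split=> //.
    have z := z1 (i + e i).+1 ltac:(lia).
    by rewrite ltnNge; apply/negP => h; have [] := hR (i + e i).+1; lia.
  - move=> i hi; have [p1 d1 a1 m1 z1] := hR i hi; split=> //.
    rewrite ltnNge; apply/negP => h.
    have z := z1 (i - e i - 1) ltac:(lia).
    by have [] := hL (i - e i - 1); lia.
  - move=> ap ep; have [? ?] := hp ap ep; split=> //; [apply: e1|apply: em]; lia.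
case: (boolP [exists p : 'I_m.+1, (al < p <= m - de) && (e p != 0)]).
  case/existsP=> p /andP[hp ep]; exists al, de, p; apply/com; split.
    move=> i hi ip; apply/eqP/negPn/negP => ei.
    have [||h] := ltngtP i p; last by [].
      by move=> h; have [] := mid i p (e1p i _ ei) h (emp p _ ep); lia.
    by move=> h; have [] := mid p i (e1p p _ ep) h (emp i _ ei); lia.
  move=> _ p0.
  have pa : p != al.+1 :> nat by apply: contraNneq ep => ->; rewrite a0.
  have pd : p != m - de :> nat by apply: contraNneq ep => ->; rewrite d0.
  have isol q : al < q <= m - de -> q != p -> e q = 0.
    move=> hq qp; apply/eqP/negPn/negP => eq.
    have [||h] := ltngtP q p; last by lia.
      by move=> h; have [] := mid q p (e1p q _ eq) h (emp p _ ep); lia.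
    by move=> h; have [] := mid p q (e1p p _ ep) h (emp q _ eq); lia.
  (* Both neighbours of the bump vanish, so at height [e p] there are zeros at [p + e p + 1] and
     [p - 1 - e p]; these cannot lie on the slopes. *)
  have z1 := isol p.+1 ltac:(lia) ltac:(lia).
  have z2 := isol p.-1 ltac:(lia) ltac:(lia).
  have [D1 D2] := @ds p (e p) ltac:(lia) ltac:(lia).
  have [U1 U2] := @us p.-1 (e p) ltac:(lia) ltac:(rewrite prednK; lia).
  split.
    rewrite ltnNge; apply/negP => h; have [] := hL (p.-1 - e p); lia.
  by rewrite leqNgt; apply/negP => h; have [] := hR (p + e p).+1; lia.
(* [p = 0] is outside the middle range and encodes the absence of a bump. *)
move=> /existsPn h; exists al, de, 0; apply/com; split; last lia.
move=> i hi _; have im : i < m.+1 by lia.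
by have := h (Ordinal im); rewrite /= hi /= negbK => /eqP.
Qed.

End Profile.

(** * Classes A and B as curves *)

Section Classes.
Local Open Scope ring_scope.
Variables (m : nat) (hm : (2 <= m)%N).
Notation n := (2 * m%:Z - 1).
Notation ed x y := (edge (vx m x) (vx m y)).

(** Half-open index ranges let consecutive pieces of the curve be concatenated. *)
Definition arc (e : nat -> nat) (s t : nat) : {set {set V m}} :=
  [set cedge m 0 e i | i : 'I_m.+1 & (s < i <= t)%N].

Lemma arcP e s t x : (t <= m)%N ->
  reflect (exists2 i : nat, (s < i <= t)%N & x = cedge m 0 e i) (x \in arc e s t).
Proof.
move=> tm; apply: (iffP imsetP) => [[i]|[i hi ->]].
  by rewrite inE => hi ->; exists i.
have hi' : (i < m.+1)%N by lia.
by exists (Ordinal hi'); rewrite ?inE.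
Qed.

Lemma arcU e s t u : (s <= t <= u)%N -> (u <= m)%N ->
  arc e s t :|: arc e t u = arc e s u.
Proof.
move=> h um; apply/setP => x; rewrite inE; apply/orP/idP.
  by case=> /arcP[|i hi ->]; try lia; apply/arcP => //; exists i => //; lia.
case/arcP=> // i hi ->; have [it|it] := leqP i t; [left|right];
  by apply/arcP; [lia|exists i => //; lia].
Qed.

Lemma bpath_arc e s t : (t <= m)%N ->
  (forall i, (s < i <= t)%N -> e i = 0%N) -> bpath m s t = arc e s t.
Proof.
move=> tm e0; apply/setP => x; apply/imsetP/arcP => // -[i].
  (* [bpath] indexes [[u, u+1]] by its left end, [cedge] by its right end. *)
  rewrite inE => hi ->; exists i.+1; first lia.
  by rewrite /cedge e0; last lia; congr edge; congr vx; lia.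
move=> hi ->; have hi' : (i.-1 < m.+1)%N by lia.
exists (Ordinal hi') => /=; first by rewrite inE /=; lia.
by rewrite /cedge e0 //; congr edge; congr vx; lia.
Qed.

Lemma left_edges_arc e eps al : (al <= m)%N ->
  (forall i, (1 <= i <= al)%N -> e i = eps i) -> left_edges m al eps = arc e 0 al.
Proof.
move=> am E; apply: eq_in_imset => i; rewrite inE => hi.
by rewrite /cedge E //; congr edge; congr vx; lia.
Qed.

Lemma right_edges_arc e xi de : (de <= m)%N ->
  (forall j, (1 <= j <= de)%N -> e (m.+1 - j)%N = xi j) ->
  right_edges m de xi = arc e (m - de) m.
Proof.
move=> dm E; apply/setP => x; apply/imsetP/arcP => // -[i].
  rewrite inE => hi ->; exists (m.+1 - i)%N; first lia.
  by rewrite /cedge E //; congr edge; congr vx; lia.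
move=> hi ->; have hi' : (m.+1 - i < m.+1)%N by lia.
exists (Ordinal hi') => /=; first by rewrite inE /=; lia.
rewrite /cedge -E; last lia.
by rewrite (_ : (_ - (_ - _))%N = i); [congr edge; congr vx; lia|lia].
Qed.

Lemma single_arc e p : (1 <= p <= m)%N -> [set cedge m 0 e p] = arc e p.-1 p.
Proof.
move=> hp; apply/setP => x; rewrite inE; apply/eqP/arcP => [|->|[i hi ->]]; first lia.
  by exists p => //; lia.
by congr cedge; lia.
Qed.

Lemma classA_curve e eps xi al de : (al + de <= m)%N ->
  (forall i, (1 <= i <= al)%N -> e i = eps i) ->
  (forall j, (1 <= j <= de)%N -> e (m.+1 - j)%N = xi j) ->
  (forall i, (al < i <= m - de)%N -> e i = 0%N) ->
  bpath m al (m - de) :|: left_edges m al eps :|: right_edges m de xi = curve m 0 e.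
Proof.
move=> ad El Er E0.
rewrite (@bpath_arc e) ?(left_edges_arc _ El) ?(right_edges_arc _ Er) //; try lia.
by rewrite [arc e al _ :|: _]setUC !arcU //; lia.
Qed.

(** The extra chord has the direction of the boundary edge missing between the two boundary paths,
    whose index is [al + be + 1]. *)
Lemma classB_curve e eps xi al be ga de eta : (be + ga + al + de + 1 = m)%N ->
  (forall i, (1 <= i <= al)%N -> e i = eps i) ->
  (forall j, (1 <= j <= de)%N -> e (m.+1 - j)%N = xi j) ->
  (forall i, (al < i <= m - de)%N -> i <> (al + be).+1 -> e i = 0%N) ->
  e (al + be).+1 = eta ->
  bpath m al (al + be) :|: bpath m (al + be).+1 (m - de)
    :|: [set ed (al%:Z + be%:Z - eta%:Z) (al%:Z + be%:Z + 1 + eta%:Z)]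
    :|: left_edges m al eps :|: right_edges m de xi = curve m 0 e.
Proof.
move=> hs El Er E0 Ep.
have -> : ed (al%:Z + be%:Z - eta%:Z) (al%:Z + be%:Z + 1 + eta%:Z)
          = cedge m 0 e (al + be).+1.
  by rewrite /cedge Ep; congr edge; congr vx; lia.
rewrite (@bpath_arc e al) ?(@bpath_arc e (al + be).+1); try by [lia|move=> i hi; apply: E0; lia].
rewrite (left_edges_arc _ El) ?(right_edges_arc _ Er) ?single_arc /=; try lia.
rewrite -[arc e _ _ :|: _ :|: arc e (al + be) _]setUA [arc e _ (m - de) :|: _]setUC.
rewrite arcU; [|lia|lia]; rewrite arcU; [|lia|lia]; rewrite [arc e al _ :|: _]setUC.
by rewrite !arcU //; lia.
Qed.

Lemma profile_class e al de p : profile m e al de p ->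
  ClassA (curve m 0 e) \/ ClassB (curve m 0 e).
Proof.
case=> ad hL hR [he h0] hp.
have El i : (1 <= i <= al)%N -> e i = e i by [].
have Er j : (1 <= j <= de)%N -> e (m.+1 - j)%N = e (m.+1 - j)%N by [].
have dL i : (1 <= i)%N -> (i < al)%N -> (e i.+1 < e i)%N.
  by move=> i1 ia; have [_ _ _] := hL i ltac:(lia); apply.
have dR j : (1 <= j)%N -> (j < de)%N -> (e (m.+1 - j.+1) < e (m.+1 - j))%N.
  move=> j1 jd; have [_ _ _] := hR (m.+1 - j)%N ltac:(lia).
  rewrite (_ : (m.+1 - j).-1 = m.+1 - j.+1)%N; [apply|]; lia.
case: (boolP ((al < p <= m - de)%N && (0 < e p)%N)) => [/andP[pm ep]|hn].
  right; have [h1 h2 h3 h4] := hp pm ep.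
  (* [beta] and [gamma] are the lengths of the boundary paths on the two sides of the bump. *)
  exists al, de, (p.-1 - al)%N, (m - de - p)%N, (e p), e, (fun j => e (m.+1 - j)%N).
  split.
  - by split; lia.
  - by lia.
  - split=> //; last by move=> i /hL[].
    by move=> a0; have := h3 1%N ltac:(lia); lia.
  - split=> //.
      by move=> d0; have := h4 m ltac:(lia); rewrite subSS subn0; lia.
    by move=> j hj; have [] := hR (m.+1 - j)%N ltac:(lia).
  - have E : p = (al + (p.-1 - al)).+1 by lia.
    symmetry; apply: (@classB_curve e e _ _ _ (m - de - p)%N) => //; try lia.
      by move=> i hi; rewrite -E; apply: h0.
    by rewrite -E.
left; exists al, de, e, (fun j => e (m.+1 - j)%N); split => //.
- split=> // i hi; have [*] := hL i hi; split; lia.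
- split=> // j hj; have [*] := hR (m.+1 - j)%N ltac:(lia); split; lia.
- by move=> a0 d0; rewrite subSS subn0 he.
symmetry; apply: classA_curve => //; first lia.
move=> i hi; have [ip|/eqP ip] := eqVneq i p; last exact: h0.
by subst i; move: hn; rewrite hi /= -eqn0Ngt => /eqP.
Qed.

Definition glue (al de : nat) (eps mid xi : nat -> nat) (i : nat) : nat :=
  if (i <= al)%N then eps i else if (i <= m - de)%N then mid i else xi (m.+1 - i)%N.

Lemma glueL al de eps mid xi i : (i <= al)%N -> glue al de eps mid xi i = eps i.
Proof. by rewrite /glue => ->. Qed.

Lemma glueM al de eps mid xi i : (al < i <= m - de)%N -> glue al de eps mid xi i = mid i.
Proof. by move=> hi; rewrite /glue ifF ?ifT //; lia. Qed.

Lemma glueR al de eps mid xi i : (al + de <= m)%N -> (m - de < i)%N ->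
  glue al de eps mid xi i = xi (m.+1 - i)%N.
Proof. by move=> h1 h2; rewrite /glue !ifF //; lia. Qed.

(** [f i + i] does not increase with [i] and exceeds [a] at [i = a]. For class B this extends the
    bound on the first chord to all of them. *)
Lemma decreasing_bound (f : nat -> nat) a :
  (forall i, (1 <= i)%N -> (i < a)%N -> (f i.+1 < f i)%N) ->
  (forall i, (1 <= i <= a)%N -> (0 < f i)%N) ->
  forall i, (1 <= i <= a)%N -> (a < f i + i)%N /\ (f i + i <= f 1 + 1)%N.
Proof.
move=> d p; have A i : (i < a)%N -> (f i.+1 + i.+1 <= f 1 + 1)%N.
  elim: i => [|i IH] hi; first lia.
  by have := d i.+1 ltac:(lia) hi; have := IH ltac:(lia); lia.
have B t : (t < a)%N -> (a < f (a - t) + (a - t))%N.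
  elim: t => [|t IH] ht; first by have := p a; rewrite subn0; lia.
  have := IH ltac:(lia); have := d (a - t.+1)%N ltac:(lia) ltac:(lia).
  by rewrite (_ : (a - t.+1).+1 = (a - t)%N); lia.
move=> i hi; split.
  by have := B (a - i)%N ltac:(lia); rewrite (_ : (a - (a - i))%N = i); lia.
by have := A i.-1 ltac:(lia); rewrite prednK; lia.
Qed.

Lemma classA_profile C : ClassA C ->
  exists e al de p, profile m e al de p /\ C = curve m 0 e.
Proof.
case=> al [de [eps [xi [ad [dL bL] [dR bR] he ->]]]].
pose e := glue al de eps (fun=> 0%N) xi.
have El i : (1 <= i <= al)%N -> e i = eps i by move=> hi; apply: glueL; lia.
have Er j : (1 <= j <= de)%N -> e (m.+1 - j)%N = xi j.
  by move=> hj; rewrite /e glueR; [congr xi| |]; lia.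
have E0 i : (al < i <= m - de)%N -> e i = 0%N by move=> hi; apply: glueM.
exists e, al, de, 0%N; split; last by apply: classA_curve => //; lia.
split=> //.
- move=> i hi; have [*] := bL i hi; rewrite El //; split; try lia.
  by move=> ia; rewrite El; [apply: dL|]; lia.
- move=> i hi; have hj : (1 <= m.+1 - i <= de)%N by lia.
  have [*] := bR _ hj; have E := Er _ hj.
  rewrite (_ : (m.+1 - (m.+1 - i))%N = i) in E; last lia.
  rewrite E; split; try lia.
  move=> ia; have := @Er (m.+1 - i).+1 ltac:(lia).
  rewrite (_ : (m.+1 - (m.+1 - i).+1)%N = i.-1); last lia.
  by move=> ->; apply: dR; lia.
- split=> [a0 d0|i hi _]; last exact: E0.
  have E1 := El 1%N ltac:(lia); have Em := Er 1%N ltac:(lia).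
  by rewrite subSS subn0 in Em; rewrite E1 Em; apply: he.
Qed.

Lemma classB_profile C : ClassB C ->
  exists e al de p, profile m e al de p /\ C = curve m 0 e.
Proof.
case=> al [de [be [ga [eta [eps [xi [[b2 g2 ad hs] [eta1 heta] [L1 dL pL] [R1 dR pR] ->]]]]]]].
pose e := glue al de eps (fun i => if i == (al + be).+1 then eta else 0%N) xi.
have El i : (1 <= i <= al)%N -> e i = eps i by move=> hi; apply: glueL; lia.
have Er j : (1 <= j <= de)%N -> e (m.+1 - j)%N = xi j.
  by move=> hj; rewrite /e glueR; [congr xi| |]; lia.
have E0 i : (al < i <= m - de)%N -> i <> (al + be).+1 -> e i = 0%N.
  by move=> hi /eqP hp; rewrite /e glueM // (negbTE hp).
have Ep : e (al + be).+1 = eta by rewrite /e glueM ?eqxx //; lia.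
have bL := decreasing_bound dL pL; have bR := decreasing_bound dR pR.
exists e, al, de, (al + be).+1; split; last by apply: classB_curve hs _ _ _ _ => //.
have Er' i : (m - de < i <= m)%N -> e i = xi (m.+1 - i)%N.
  by move=> hi; rewrite /e glueR //; lia.
split.
- lia.
- move=> i hi; have [*] := bL i hi; have := pL i hi; have := L1 ltac:(lia).
  rewrite El //; split; try lia.
  by move=> ia; rewrite El; [apply: dL|]; lia.
- move=> i hi; have hj : (1 <= m.+1 - i <= de)%N by lia.
  have [*] := bR _ hj; have := pR _ hj; have := R1 ltac:(lia).
  rewrite Er' //; split; try lia.
  move=> ia; rewrite Er'; last lia.
  by rewrite (_ : (m.+1 - i.-1 = (m.+1 - i).+1)%N); [apply: dR|]; lia.
- split=> // a0 d0; have := L1 a0; have := R1 d0.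
  rewrite El ?Er'; [|lia..]; rewrite subSn // subnn; lia.
- move=> _ _; rewrite Ep; split; [lia|lia| |].
    by move=> i hi; have [*] := bL i hi; have := L1 ltac:(lia); rewrite El //; lia.
  move=> i hi; have hj : (1 <= m.+1 - i <= de)%N by lia.
  have [*] := bR _ hj; have := pR _ hj; have := R1 ltac:(lia).
  by rewrite Er' //; lia.
Qed.

Lemma class_profile C : ClassA C \/ ClassB C ->
  exists e al de p, profile m e al de p /\ C = curve m 0 e.
Proof. by case=> [/classA_profile|/classB_profile]. Qed.

End Classes.

(** * Directions and size of blockers *)

Section Directions.
Local Open Scope ring_scope.
Variables (m : nat) (hm : (2 <= m)%N).
Notation n := (2 * m%:Z - 1).
Notation ed x y := (edge (vx m x) (vx m y)).

Lemma vx_residue z : exists q, (vx m z : nat)%:Z = z + q * n.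
Proof. by apply/(vx_eqP hm); rewrite vx_val_id. Qed.

Lemma dir_edge (x y : V m) : x != y ->
  dir (edge x y) = vx m ((x : nat)%:Z + (y : nat)%:Z).
Proof. by move=> xy; rewrite /dir /edge big_setU1 ?inE //= big_set1 PoszD. Qed.

Lemma dir_vx_edge x y : vx m x != vx m y -> dir (ed x y) = vx m (x + y).
Proof.
move=> /dir_edge->; have [q ->] := vx_residue x; have [q' ->] := vx_residue y.
by apply/(vx_eqP hm); exists (q + q'); lia.
Qed.

Lemma hits_dir (B : {set {set V m}}) (c : int) : hits_all_SHP B ->
  exists2 f, f \in B & dir f = vx m c \/ dir f = vx m (c + 1).
Proof.
move=> /(hits_not_complete hm) nc.
case: (boolP [exists f in B, (dir f == vx m c) || (dir f == vx m (c + 1))]).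
  by case/exists_inP => f fB /orP[]/eqP h; exists f; auto.
move=> /exists_inPn h; case: nc.
(* Since [2m] is [1] modulo [n], a zigzag from the vertex [(c+1)m] uses exactly the directions [c]
   and [c+1]. *)
apply: (@zigzag_right_complete _ _ ((c + 1) * m%:Z) ((c + 1) * m%:Z)).
- exact: run_start.
- lia.
move=> x y hs hc; apply/negP => /h /negP; apply.
rewrite dir_vx_edge; last by apply/eqP => /(vx_inj_near hm); lia.
by apply/orP; case: hc => ->; [left|right]; apply/eqP/(vx_eqP hm);
  exists (c + 1); lia.
Qed.

Lemma cedge_dir a e i : small m e -> (1 <= i <= m)%N ->
  dir (cedge m a e i) = vx m (2 * a + 2 * i%:Z - 1).
Proof.
move=> se hi; have ei := se i hi; rewrite dir_vx_edge; first by congr vx; lia.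
by apply/eqP => /(vx_inj_near hm); lia.
Qed.

Lemma curve_edges a e : small m e -> {subset curve m a e <= is_edge (m:=m)}.
Proof.
move=> se f /curveP[i hi ->]; have ei := se i hi.
rewrite unfold_in /is_edge cards2 eqSS eqb1.
by apply/eqP => /(vx_inj_near hm); lia.
Qed.

Lemma card_curve a e : (#|curve m a e| <= m)%N.
Proof.
apply: leq_trans (leq_imset_card _ _) _.
have -> : [set i : 'I_m.+1 | (1 <= i <= m)%N] = ~: [set ord0].
  by apply/setP => i; rewrite !inE -val_eqE /=; have := ltn_ord i; lia.
by rewrite cardsC1 card_ord.
Qed.

(** The direction set [D] meets every pair [c, c+1], so [D] and its shift cover all [2m - 1]
    directions. If [D] has [m] elements, they overlap in a single [d0], and after [d0 + 1] every
    second direction belongs to [D]. *)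
Lemma hits_card (B : {set {set V m}}) : hits_all_SHP B -> (m <= #|B|)%N /\
  (#|B| = m -> {in B &, injective (@dir m)} /\
    exists a0 : int, forall t : nat, (t < m)%N -> vx m (a0 + 1 + 2 * t%:Z) \in (@dir m) @: B).
Proof.
move=> hB; set D := (@dir m) @: B.
have DD c : vx m c \in D \/ vx m (c + 1) \in D.
  have [f fB [<-|<-]] := hits_dir c hB; [left|right]; exact: imset_f.
pose s (d : V m) := vx m ((d : nat)%:Z + 1).
have sE z : s (vx m z) = vx m (z + 1).
  by have [q E] := vx_residue z; apply/(vx_eqP hm); exists q; rewrite E; lia.
have s_inj : injective s.
  move=> x y; rewrite -(vx_val_id hm x) -(vx_val_id hm y) !sE.
  move=> /(vx_eqP hm)[q E]; apply/(vx_eqP hm); exists q; lia.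
pose D' := s @^-1: D.
have cD' : #|D'| = #|D|.
  exact: card_preimset.
have U : D :|: D' = setT.
  apply/setP => d; rewrite !inE -(vx_val_id hm d) sE.
  by apply/orP; exact: DD.
have := cardsUI D D'; rewrite U cardsT card_ord cD' => cUI.
have DB : (#|D| <= #|B|)%N by exact: leq_imset_card.
split; first lia.
move=> Bm; have Dm : #|D| = m by lia.
split; first by apply/imset_injP; rewrite -/D Dm Bm.
have /eqP/cards1P[d0 Id0] : #|D :&: D'| = 1%N by lia.
exists (d0 : nat)%:Z.
have d0D : vx m ((d0 : nat)%:Z + 1) \in D.
  by have := set11 d0; rewrite -Id0 !inE => /andP[_].
elim=> [|t IH] ht; first by rewrite addr0.
set c := (_ + 2 * t%:Z) in IH.
have [h|] := DD (c + 1); last by congr (vx m _ \in D); lia.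
(* Otherwise [c] would be a second element of the overlap. *)
have : vx m c \in D :&: D' by rewrite !inE sE h IH //; lia.
rewrite Id0 inE => /eqP; rewrite -[RHS](vx_val_id hm) => /(vx_inj_near hm).
by rewrite /c; lia.
Qed.

Lemma edge_of_dir (a : int) (i : nat) (f : {set V m}) : is_edge f ->
  dir f = vx m (2 * a + 2 * i%:Z - 1) ->
  exists u : nat, (u + 2 <= m)%N /\
    f = ed (a + i%:Z - 1 - u%:Z) (a + i%:Z + u%:Z).
Proof.
move=> /cards2P[x [y [xy ->]]].
rewrite -/(edge x y) dir_edge // => /(vx_eqP hm)[q E].
have [w hw xw] := vx_repr hm (a + i%:Z - m%:Z) x.
have yE : y = vx m (2 * a + 2 * i%:Z - 1 - w).
  have [q' E'] := vx_residue w; rewrite -xw in E'.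
  by rewrite -[LHS](vx_val_id hm); apply/(vx_eqP hm); exists (q - q'); lia.
rewrite yE xw.
have [wi|wi] := lerP w (a + i%:Z - 1).
  (* This vertex is its own mirror image modulo [n], so it spans no edge of the direction. *)
  have wm : w != a + i%:Z - m%:Z.
    apply: contraNneq xy => wE; rewrite xw yE; apply/eqP/(vx_eqP hm).
    by exists (-1); lia.
  exists (absz (a + i%:Z - 1 - w)%R); split; first lia.
  by congr edge; congr vx; lia.
exists (absz (w - a - i%:Z)%R); split; first lia.
by rewrite edgeC; congr edge; congr vx; lia.
Qed.

Lemma rot_curve (k : V m) e : rot_edges k (curve m 0 e) = curve m (k : nat)%:Z e.
Proof.
have E i : (fun x : V m => vx m ((x : nat)%:Z + (k : nat)%:Z)) @: cedge m 0 e i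
           = cedge m (k : nat)%:Z e i.
  have R z : vx m ((vx m z : nat)%:Z + (k : nat)%:Z) = vx m (z + (k : nat)%:Z).
    by have [q E] := vx_residue z; apply/(vx_eqP hm); exists q; rewrite E; lia.
  by rewrite /cedge /edge imsetU1 imset_set1 !R; congr edge; congr vx; lia.
apply/setP => x; apply/imsetP/curveP => [[f /curveP[i hi ->] ->]|[i hi ->]].
  by exists i => //; exact: E.
by exists (cedge m 0 e i); [apply/curveP; exists i|rewrite E].
Qed.

Lemma profile_hits e al de p : profile m e al de p -> hits_all_SHP (curve m 0 e).
Proof.
move=> P; apply/(hits_curve hm 0 (profile_small hm P)).
apply: not_complete_off => //.
- exact: profile_small P.
- exact: profile_descent P.
- exact: profile_ascent P.
- exact: profile_ends P.
- exact: profile_middle P.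
Qed.

Lemma curve_profile a e : small m e -> hits_all_SHP (curve m a e) ->
  exists al de p, profile m e al de p.
Proof.
move=> se /(hits_curve hm a se) nc; apply: profile_exists => //.
- exact: descent_necessary.
- exact: ascent_necessary.
- exact: ends_necessary.
- exact: middle_necessary.
Qed.

(** The boundary path of [m] edges, [e = 0], already hits every path. *)
Lemma blocker_card (B : {set {set V m}}) : blocker B -> #|B| = m.
Proof.
case=> _ hB minB; apply/eqP; rewrite eqn_leq (hits_card hB).1 andbT.
have P : profile m (fun=> 0%N) 0 0 0 by split=> //; lia.
apply: leq_trans (card_curve 0 (fun=> 0%N)); apply: minB.
  exact: curve_edges (profile_small hm P).
exact: profile_hits P.
Qed.

Lemma blocker_structure (B : {set {set V m}}) : blocker B ->
  [/\ #|B| = m, {in B &, injective (@dir m)} &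
    exists (a : V m) (e : nat -> nat), small m e /\ B = curve m (a : nat)%:Z e].
Proof.
move=> bB; have Bm := blocker_card bB; case: bB => Be hB _.
have [_ /(_ Bm)[inj [a0 Da]]] := hits_card hB; split=> //.
(* [a0 * m] is half of [a0] modulo [n], so direction [a0 + 1 + 2t] is that of index [t + 1] in the
   curve at [a]. *)
pose a := vx m (a0 * m%:Z); exists a.
have [q aE] := vx_residue (a0 * m%:Z).
have ex (i : 'I_m.+1) : exists u : nat, (1 <= i)%N ->
    (u + 2 <= m)%N /\ ed ((a : nat)%:Z + i%:Z - 1 - u%:Z) ((a : nat)%:Z + i%:Z + u%:Z) \in B.
  have [i0|i1] := posnP i; first by exists 0%N; rewrite i0.
  have /imsetP[f fB df] := Da i.-1 ltac:(have := ltn_ord i; lia).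
  have [||u [um fE]] := @edge_of_dir (a : nat)%:Z i f; first exact: Be.
    by rewrite -df; apply/(vx_eqP hm); exists (- 2 * q - a0); rewrite aE; lia.
  by exists u; rewrite -fE.
have [g gP] := fin_all_exists ex.
pose e i := g (inord i); exists e.
have eP i : (1 <= i <= m)%N -> (e i + 2 <= m)%N /\ cedge m (a : nat)%:Z e i \in B.
  by move=> hi; have := gP (inord i); rewrite inordK; [apply|]; lia.
have se : small m e by move=> i /eP[].
split=> //; apply/eqP; rewrite eq_sym eqEcard; apply/andP; split.
  by apply/subsetP => f /curveP[i /eP[_ h] ->].
have ci : {in [set i : 'I_m.+1 | (1 <= i <= m)%N] &,
            injective (fun i : 'I_m.+1 => cedge m (a : nat)%:Z e i)}.
  move=> i j; rewrite !inE => hi hj /(congr1 (@dir m)); rewrite !cedge_dir //.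
  by move=> /(vx_inj_near hm) h; apply: val_inj => /=; lia.
rewrite /curve (card_in_imset ci).
have -> : [set i : 'I_m.+1 | (1 <= i <= m)%N] = ~: [set ord0].
  by apply/setP => i; rewrite !inE -val_eqE /=; have := ltn_ord i; lia.
by rewrite cardsC1 card_ord Bm.
Qed.

Lemma curve_dirs (a : V m) e : small m e -> [set dir f | f in curve m (a : nat)%:Z e] =
  [set vx m (2 * a + 1 + 2 * t)%N%:Z | t : 'I_m].
Proof.
move=> se; apply/setP => d; apply/imsetP/imsetP => [[f /curveP[i hi ->] ->]|[t _ ->]].
  have hi' : (i.-1 < m)%N by lia.
  by exists (Ordinal hi'); rewrite // cedge_dir //=; congr vx; lia.
have ht := ltn_ord t.
exists (cedge m (a : nat)%:Z e t.+1); first by apply/curveP; exists t.+1.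
by rewrite cedge_dir //; congr vx; lia.
Qed.

End Directions.

Theorem mainTheorem1 (m : nat) (hm : (2 <= m)%N) :
  (forall B : {set {set V m}}, blocker B ->
     [/\ #|B| = m,
         {in B &, injective (@dir m)},
         (exists a : V m,
            [set dir e | e in B] = [set vx m (2 * a + 1 + 2 * t)%N%:Z | t : 'I_m])
       & exists (k : V m) (C : {set {set V m}}),
           (ClassA C \/ ClassB C) /\ B = rot_edges k C])
  /\ (forall C : {set {set V m}}, ClassA C \/ ClassB C -> blocker C).
Proof.
split=> [B bB|C /(class_profile hm)[e [al [de [p [P ->]]]]]].
  have [Bm inj [a [e [se EB]]]] := blocker_structure hm bB.
  have [al [de [p P]]] : exists al de p, profile m e al de p.
    by apply: (curve_profile hm (a := (a : nat)%:Z)) => //; rewrite -EB; case: bB.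
  split=> //; first by exists a; rewrite EB; exact: curve_dirs.
  exists a, (curve m 0 e); rewrite (rot_curve hm); split=> //.
  exact: profile_class P.
split; first exact: curve_edges (profile_small hm P).
  exact: (profile_hits hm P).
by move=> B' _ /(hits_card hm)[mB' _]; exact: leq_trans (card_curve hm _ _) mB'.
Qed.
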